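(* Let $n>1$, let $G=\mathsf{P}\mathsf{GL}(n+1,\mathbb{H})$ and $G_0=\mathsf{GL}(n,\mathbb{H})\mathsf{Sp}(1)\subset G$. The $8n$-dimensional homogeneous space $M=G/G_0$ has a natural torsion-free $G$-invariant quaternionic skew-Hermitian structure. In particular, the invariant scalar 2-form $\omega_{\mathsf W}$ is induced by the pairing between $\mathfrak{g}_-$ and $\mathfrak{p}_+$ provided by the Killing form of $\mathfrak{sl}(n+1,\mathbb{H})$, that is, $\mathfrak{g}_-\cong[\mathsf{EH}]$ and $\mathfrak{p}_+\cong[\mathsf{EH}]^*$.
   Context: $G_0$ is a Levi subgroup of the parabolic subgroup $P\subset G$ stabilizing the quaternionic line spanned by the first basis vector of $\mathbb{H}^{n+1}$; there is a $G_0$-invariant decomposition $\mathfrak{g}=\mathfrak{sl}(n+1,\mathbb{H})=\mathfrak{g}_-\oplus\mathfrak{g}_0\oplus\mathfrak{p}_+$ with $\mathfrak{p}=\mathfrak{g}_0\oplus\mathfrak{p}_+$, so $TM=G\times_{G_0}(\mathfrak{g}_-\oplus\mathfrak{p}_+)$. The linear quaternionic structure on $\mathfrak{g}_-\oplus\mathfrak{p}_+$ is the natural one, given by the action of the ideal $\mathfrak{sp}(1)\subset\mathfrak{g}_0$ on $\mathfrak{g}_-\cong[\mathsf{EH}]$ and $\mathfrak{p}_+\cong[\mathsf{EH}]^*$, where here $[\mathsf{EH}]\cong\mathbb{H}^n$ with $\mathsf E=\mathbb{C}^{2n}$, $\mathsf H=\mathbb{C}^2$ the standard representations of $\mathsf{GL}(n,\mathbb{H})$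 and $\mathsf{Sp}(1)$. An almost quaternionic structure $Q\subset\mathrm{End}(TM)$ is a rank 3 subbundle locally spanned by triples $\{J_1,J_2,J_3\}$ of almost complex structures with $J_1J_2=-J_2J_1=J_3$; an almost quaternionic skew-Hermitian structure is a pair $(Q,\omega)$ where $\omega$ is a scalar 2-form: a non-degenerate 2-form with $\omega(J_aX,J_aY)=\omega(X,Y)$. It is torsion-free (then called quaternionic skew-Hermitian) if there is a torsion-free connection preserving both $Q$ and $\omega$, i.e. the intrinsic torsion of the corresponding $G$-structure vanishes. *)

(* Defs.v *)
From HB Require Import structures.
From mathcomp Require Import all_boot all_order all_algebra.
From mathcomp Require Import all_classical all_reals all_analysis.

Set Implicit Arguments.
Unset Strict Implicit.
Unset Printing Implicit Defensive.

Import Order.TTheory GRing.Theory Num.Theory numFieldNormedType.Exports.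

Local Open Scope classical_set_scope.
Local Open Scope ring_scope.

(* Differential geometry on M = G/G_0 is done on G, as usual for homogeneous
   bundles: a section of G x_{G_0} W over an open subset of M is a smooth map
   s on its preimage in G with values in W such that s (g h) = h^-1 . s g for
   h in G_0.  In particular TM = G x_{G_0} (g_- + p_+), where v in g_- + p_+
   represents, at g G_0, the velocity at t = 0 of the curve g exp(t v) G_0. *)

(* (A0, A1, A2, A3) stands for A0 + i A1 + j A2 + k A3; real matrices commute
   with i, j, k.  In this form Mat_{m,n}(H) inherits the real vector space and
   the normed space structures of the library. *)
Definition qmx (R : realType) (m n : nat) : Type :=
  ('M[R]_(m, n) * 'M[R]_(m, n) * 'M[R]_(m, n) * 'M[R]_(m, n))%type.

Section QuaternionicMatrices.
Context {R : realType}.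

Definition qre m n (A : qmx R m n) : 'M[R]_(m, n) := A.1.1.1.
Definition qimi m n (A : qmx R m n) : 'M[R]_(m, n) := A.1.1.2.
Definition qimj m n (A : qmx R m n) : 'M[R]_(m, n) := A.1.2.
Definition qimk m n (A : qmx R m n) : 'M[R]_(m, n) := A.2.

Definition qmul m n p (A : qmx R m n) (B : qmx R n p) : qmx R m p :=
  (qre A *m qre B - qimi A *m qimi B - qimj A *m qimj B - qimk A *m qimk B,
   qre A *m qimi B + qimi A *m qre B + qimj A *m qimk B - qimk A *m qimj B,
   qre A *m qimj B - qimi A *m qimk B + qimj A *m qre B + qimk A *m qimi B,
   qre A *m qimk B + qimi A *m qimj B - qimj A *m qimi B + qimk A *m qre B).

Definition qone m : qmx R m m := (1%:M, 0, 0, 0).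

Definition qblock m1 m2 n1 n2
    (a : qmx R m1 n1) (b : qmx R m1 n2) (c : qmx R m2 n1) (d : qmx R m2 n2) :
    qmx R (m1 + m2) (n1 + n2) :=
  (block_mx (qre a) (qre b) (qre c) (qre d),
   block_mx (qimi a) (qimi b) (qimi c) (qimi d),
   block_mx (qimj a) (qimj b) (qimj c) (qimj d),
   block_mx (qimk a) (qimk b) (qimk c) (qimk d)).

Definition qinverse m (A B : qmx R m m) : Prop :=
  qmul A B = qone m /\ qmul B A = qone m.

(* GL(m, H) *)
Definition GLH m : set (qmx R m m) := [set A | exists B, qinverse A B].

(* Sp(1), the group of unit quaternions *)
Definition Sp1 : set (qmx R 1 1) :=
  [set a | qre a 0 0 ^+ 2 + qimi a 0 0 ^+ 2 + qimj a 0 0 ^+ 2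
           + qimk a 0 0 ^+ 2 = 1].

Lemma qmul1 m : qmul (qone m) (qone m) = qone m.
Proof.
by rewrite /qmul /qone /qre /qimi /qimj /qimk /= !mul0mx !mulmx0 mulmx1
  !subr0 !addr0.
Qed.

Lemma GLH1 m : GLH (qone m).
Proof. by exists (qone m); split; exact: qmul1. Qed.

Definition qlie m (A B : qmx R m m) : qmx R m m := qmul A B - qmul B A.

End QuaternionicMatrices.

Section Smooth.
Context {R : realType} {V : normedModType R}.

Definition iter_deriv (vs : seq V) (f : V -> R^o) : V -> R^o :=
  foldr (fun v g x => 'D_v g x) f vs.

(* U is meant to be open. *)
Definition smooth_on (U : set V) (f : V -> R^o) : Prop :=
  forall (vs : seq V) (x : V), U x ->
    {for x, continuous (iter_deriv vs f)}
    /\ forall v, derivable (iter_deriv vs f) x v.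

End Smooth.

Section HomogeneousSpace.
Context {R : realType} {n : nat}.

Local Notation gl := (qmx R (1 + n) (1 + n)).

(* sl(n+1, H) consists of the matrices whose trace has real part 0. *)
Definition sl : {vspace gl} :=
  lker (linfun (fun A : gl => \tr (qre A) : R^o)).

Definition neg_embed : 'Hom(qmx R n 1, gl) :=
  linfun (fun x : qmx R n 1 => qblock 0 0 x 0).
Definition pos_embed : 'Hom(qmx R 1 n, gl) :=
  linfun (fun z : qmx R 1 n => qblock 0 z 0 0).
Definition diag_embed : 'Hom((qmx R 1 1 * qmx R n n)%type, gl) :=
  linfun (fun ad : qmx R 1 1 * qmx R n n => qblock ad.1 0 0 ad.2).
Definition sp1_embed : 'Hom('rV[R]_3, gl) :=
  linfun (fun v : 'rV[R]_3 =>
    qblock (0, (v 0 (inord 0))%:M, (v 0 (inord 1))%:M, (v 0 (inord 2))%:M)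
           0 0 0).

Definition g_neg : {vspace gl} := limg neg_embed.
Definition g_zero : {vspace gl} := (limg diag_embed :&: sl)%VS.
Definition p_pos : {vspace gl} := limg pos_embed.
Definition sp1 : {vspace gl} := limg sp1_embed.

Definition tangent_space : {vspace gl} := (g_neg + p_pos)%VS.
Definition tangent := subvs_of tangent_space.

(* the trace of ad A \o ad B on the real Lie algebra sl(n+1, H), computed in a
   basis *)
Definition killing (A B : gl) : R :=
  \sum_(i < \dim sl)
     coord (vbasis sl) i (qlie A (qlie B (tnth (vbasis sl) i))).

Definition neg_part (u : tangent) : gl := daddv_pi g_neg p_pos (vsval u).
Definition pos_part (u : tangent) : gl := daddv_pi p_pos g_neg (vsval u).

(* an element of PGL(n+1, H) is a class of GL(n+1, H) modulo R^* *)
Definition real_class (A : gl) : set gl := [set r *: A | r in [set r | r != 0]].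
Definition PGL : Type :=
  {C : set gl | exists2 A, GLH A & C = real_class A}.

Definition pone : PGL := exist _ _ (ex_intro2 _ _ (qone (1 + n)) (GLH1 _) erefl).

(* the quotient map; the value outside GL(n+1, H) is irrelevant *)
Definition pclass (A : gl) : PGL :=
  match pselect (GLH A) with
  | left GLA => exist _ _ (ex_intro2 _ _ A GLA erefl)
  | right _ => pone
  end.

Definition prep (g : PGL) : gl := s2val (cid2 (svalP g)).
Definition prep_inv (g : PGL) : gl := xget 0 [set B | qinverse (prep g) B].

Definition pmul (g h : PGL) : PGL := pclass (qmul (prep g) (prep h)).

Definition G0 : set PGL :=
  [set g | exists a D, [/\ Sp1 a, GLH D & g = pclass (qblock a 0 0 D)]].

Definition M : Type := {x : set PGL | exists g, x = [set pmul g h | h in G0]}.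

Definition Mproj (g : PGL) : M := exist _ _ (ex_intro _ g erefl).
Definition Mrep (x : M) : PGL := sval (cid (svalP x)).

Definition openM (U : set M) : Prop :=
  open [set A : gl | GLH A /\ U (Mproj (pclass A))].

Definition Ad (g : PGL) (v : gl) : gl := qmul (qmul (prep g) v) (prep_inv g).

(* the isotropy representation of G_0 on g_- + p_+, meant for g in G_0 *)
Definition isotropy (g : PGL) : 'End(tangent) :=
  linfun (fun u : tangent => vsproj tangent_space (Ad g (vsval u))).

(* the action of sp(1), which preserves g_- + p_+; meant for s in sp(1) *)
Definition ad_tangent (s : gl) : 'End(tangent) :=
  linfun (fun u : tangent => vsproj tangent_space (qlie s (vsval u))).

(* U is meant to be open; W-valued maps are tested on linear functionals. *)
Definition smooth_section (U : set M) (W : vectType R) (s : PGL -> W) : Prop :=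
  forall phi : 'Hom(W, R^o),
    smooth_on [set A : gl | GLH A /\ U (Mproj (pclass A))]
              (fun A => phi (s (pclass A))).

Definition smooth_fun (f : M -> R) : Prop :=
  smooth_on [set A : gl | GLH A] (fun A => f (Mproj (pclass A))).

Record vector_field (X : PGL -> tangent) : Prop := VectorField {
  vf_smooth : smooth_section setT X;
  vf_equivariant : forall g h, G0 h -> isotropy h (X (pmul g h)) = X g }.

(* a section over U of the bundle End(TM) *)
Record end_field (U : set M) (J : PGL -> 'End(tangent)) : Prop := EndField {
  ef_smooth : smooth_section U J;
  ef_equivariant : forall g h, U (Mproj g) -> G0 h ->
    (isotropy h \o J (pmul g h) = J g \o isotropy h)%VF }.

Record two_form (w : PGL -> tangent -> tangent -> R) : Prop := TwoForm {
  tf_linear : forall g v, linear (fun u => w g u v : R^o);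
  tf_alternating : forall g u, w g u u = 0;
  tf_smooth : forall u v, smooth_section setT (fun g => w g u v : R^o);
  tf_equivariant : forall g h u v, G0 h ->
    w (pmul g h) u v = w g (isotropy h u) (isotropy h v) }.

(* Mrep and prep choose representatives; the values below do not depend on them
   when the arguments are equivariant. *)
Definition lie_deriv (X : PGL -> tangent) (f : M -> R) : M -> R := fun x =>
  let g := Mrep x in
  'D_(qmul (prep g) (vsval (X g)))
     (fun A : gl => f (Mproj (pclass A)) : R^o) (prep g).
Definition scale_vf (f : M -> R) (X : PGL -> tangent) : PGL -> tangent :=
  fun g => f (Mproj g) *: X g.
Definition eval_form (w : PGL -> tangent -> tangent -> R)
    (Y Z : PGL -> tangent) : M -> R :=
  fun x => w (Mrep x) (Y (Mrep x)) (Z (Mrep x)).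

Definition add_vf (X Y : PGL -> tangent) : PGL -> tangent :=
  fun g => X g + Y g.
Definition sub_vf (X Y : PGL -> tangent) : PGL -> tangent :=
  fun g => X g - Y g.

Definition quaternionic_triple (Q : {vspace 'End(tangent)})
    (J1 J2 J3 : 'End(tangent)) : Prop :=
  [/\ (J1 \o J1 = - \1)%VF, (J2 \o J2 = - \1)%VF, (J3 \o J3 = - \1)%VF,
      (J1 \o J2 = J3)%VF /\ (J2 \o J1 = - J3)%VF
    & Q = <<[:: J1; J2; J3]>>%VS].

Record almost_quaternionic (Q : PGL -> {vspace 'End(tangent)}) : Prop :=
  AlmostQuaternionic {
  aq_rank : forall g, \dim (Q g) = 3%N;
  aq_triple : forall x : M, exists (U : set M) J1 J2 J3,
    [/\ openM U, U x,
        [/\ end_field U J1, end_field U J2 & end_field U J3]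
      & forall g, U (Mproj g) -> quaternionic_triple (Q g) (J1 g) (J2 g) (J3 g)]
  }.

Record scalar_two_form (Q : PGL -> {vspace 'End(tangent)})
    (w : PGL -> tangent -> tangent -> R) : Prop := ScalarTwoForm {
  s2f_form : two_form w;
  s2f_nondegenerate : forall g u, (forall v, w g u v = 0) -> u = 0;
  s2f_hermitian : forall g J1 J2 J3, quaternionic_triple (Q g) J1 J2 J3 ->
    forall u v, [/\ w g (J1 u) (J1 v) = w g u v, w g (J2 u) (J2 v) = w g u v
                  & w g (J3 u) (J3 v) = w g u v] }.

Record connection (nabla : (PGL -> tangent) -> (PGL -> tangent) ->
                           (PGL -> tangent)) : Prop := Connection {
  conn_vf : forall X Y, vector_field X -> vector_field Y ->
    vector_field (nabla X Y);
  conn_addl : forall X X' Y,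
    vector_field X -> vector_field X' -> vector_field Y ->
    nabla (add_vf X X') Y = add_vf (nabla X Y) (nabla X' Y);
  conn_addr : forall X Y Y',
    vector_field X -> vector_field Y -> vector_field Y' ->
    nabla X (add_vf Y Y') = add_vf (nabla X Y) (nabla X Y');
  conn_scalel : forall f X Y,
    smooth_fun f -> vector_field X -> vector_field Y ->
    nabla (scale_vf f X) Y = scale_vf f (nabla X Y);
  conn_leibniz : forall f X Y,
    smooth_fun f -> vector_field X -> vector_field Y ->
    nabla X (scale_vf f Y)
      = add_vf (scale_vf (lie_deriv X f) Y) (scale_vf f (nabla X Y)) }.

(* The bracket [X, Y] is the commutator of the derivations X and Y of the
   smooth functions; a vector field is determined by its derivation. *)
Definition no_torsion nabla : Prop :=
  forall X Y f, vector_field X -> vector_field Y -> smooth_fun f ->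
    forall x, lie_deriv (sub_vf (nabla X Y) (nabla Y X)) f x
      = lie_deriv X (lie_deriv Y f) x - lie_deriv Y (lie_deriv X f) x.

Definition section_of (Q : PGL -> {vspace 'End(tangent)})
    (A : PGL -> 'End(tangent)) : Prop :=
  end_field setT A /\ forall g, A g \in Q g.

(* B is the covariant derivative nabla_X A.  Global sections suffice because
   local ones extend after multiplication by a bump function. *)
Definition preserves_Q nabla (Q : PGL -> {vspace 'End(tangent)}) : Prop :=
  forall X A, vector_field X -> section_of Q A ->
    exists2 B, section_of Q B & forall Y, vector_field Y ->
      nabla X (fun g => A g (Y g))
        = add_vf (fun g => B g (Y g)) (fun g => A g (nabla X Y g)).

Definition preserves_form nabla (w : PGL -> tangent -> tangent -> R) : Prop :=
  forall X Y Z, vector_field X -> vector_field Y -> vector_field Z ->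
    forall x, lie_deriv X (eval_form w Y Z) x
      = eval_form w (nabla X Y) Z x + eval_form w Y (nabla X Z) x.

Record quaternionic_skew_Hermitian (Q : PGL -> {vspace 'End(tangent)})
    (w : PGL -> tangent -> tangent -> R) : Prop := QuaternionicSkewHermitian {
  qsH_quaternionic : almost_quaternionic Q;
  qsH_form : scalar_two_form Q w;
  qsH_torsion_free : exists nabla, [/\ connection nabla, no_torsion nabla,
    preserves_Q nabla Q & preserves_form nabla w] }.

(* A fibre at g is read through the frame g : g_- + p_+ -> T_{g G_0} M, so
   invariance under the left action of G means independence of g. *)
Definition G_invariant T (s : PGL -> T) : Prop :=
  forall k g, s (pmul k g) = s g.

Definition Q_W : {vspace 'End(tangent)} := (linfun ad_tangent @: sp1)%VS.

Definition omega_W (u v : tangent) : R :=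
  killing (neg_part u) (pos_part v) - killing (neg_part v) (pos_part u).

(* g_- is [EH] = H^n, on which D in GL(n, H) and a in Sp(1) act by
   x |-> D x a^-1. *)
Definition neg_is_EH : Prop :=
  lker neg_embed = 0%VS /\
  forall a b D x, Sp1 a -> qinverse a b -> GLH D ->
    Ad (pclass (qblock a 0 0 D)) (neg_embed x) = neg_embed (qmul (qmul D x) b).

(* the Killing form is a G_0-invariant perfect pairing of g_- and p_+ *)
Definition killing_duality : Prop :=
  [/\ forall h x z, G0 h -> x \in g_neg -> z \in p_pos ->
        [/\ Ad h x \in g_neg, Ad h z \in p_pos
          & killing (Ad h x) (Ad h z) = killing x z],
      forall x, x \in g_neg -> (forall z, z \in p_pos -> killing x z = 0) ->
        x = 0
    & forall z, z \in p_pos -> (forall x, x \in g_neg -> killing x z = 0) ->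
        z = 0].

End HomogeneousSpace.

Arguments PGL : clear implicits.
Arguments tangent : clear implicits.
Arguments sl : clear implicits.
Arguments g_zero : clear implicits.
Arguments Q_W : clear implicits.
Arguments omega_W : clear implicits.
Arguments pone : clear implicits.
Arguments neg_is_EH : clear implicits.
Arguments killing_duality : clear implicits.

(* Main.v *)
Require Import Defs.
From HB Require Import structures.
From mathcomp Require Import all_boot all_order all_algebra.
From mathcomp Require Import all_classical all_reals all_analysis.
From mathcomp Require Import perm ring lra zify.

(* M is a symmetric space: for m = g_- + p_+ one has [m, m] <= g_0. Both Q and
   omega are given by G_0-invariant tensors on m, that is, by constant functions
   on G. The canonical connection differentiates the equivariant function Y along
   the left-invariant field on G whose value at g is X(g); constant tensors are
   parallel for it, and its torsion at g is the m-component of [X(g), Y(g)], which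
   is 0. Near the class of A, a frame of Q is given by the actions of q^-1 i q,
   q^-1 j q and q^-1 k q, where q is a nonzero entry of the first column of A: the
   element diag(a, D) of G_0 replaces q by q a. The Killing form is
   8(n+1) Re tr(AB) on sl(n+1, H), so that omega and its invariance under sp(1)
   and G_0 can be read off the blocks. *)

Set Implicit Arguments.
Unset Strict Implicit.
Unset Printing Implicit Defensive.

Import Order.TTheory GRing.Theory Num.Theory numFieldNormedType.Exports.

Local Open Scope classical_set_scope.
Local Open Scope ring_scope.

(** * Directional derivatives and smooth functions *)

(** [smooth_on] speaks of one direction at a time: nothing in it makes a derivative linear in its
    direction, or symmetric in two directions. The connection axioms need the first and the torsion
    the second. Both come from the continuity of the iterated derivatives, through the mean value
    theorem. PGL and M have no coordinates of their own. Functions on them are pulled back to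
    GL(n+1, H), an open set of a real vector space, while [prep] and [Mrep] choose representatives;
    so computations rest on an invariance, under real factors for PGL and under G_0 for M. A
    left-invariant field takes the value A u at A, and this direction moves with A. Differentiating
    twice along such fields gives a symmetric second derivative and a first order term, and the
    latter produces the Lie bracket. Torsion is tested on functions lifted from M, whose derivatives
    in the directions of g_0 vanish. Sp(1) rotates Q, so a constant nonzero endomorphism in Q is not
    an equivariant section: this is why the frame of Q has to vary with A. *)

Section DirectionalDerivatives.
Context {R : realType} {V : normedModType R}.
Implicit Types (f g : V -> R) (x u v : V) (t s : R).

(** The lock keeps conversion from unfolding the limit inside [pd]. Values lie in [R] rather than
    [R^o], so that sums and products are those of the field. *)
Fact pd_key : unit. Proof. exact: tt. Qed.
Definition pd : V -> (V -> R) -> V -> R :=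
  locked_with pd_key (fun v f x => 'D_v (f : V -> R^o) x).

Lemma pdE v f x : pd v f x = 'D_v (f : V -> R^o) x.
Proof. by rewrite /pd unlock. Qed.

Definition pdable f x v : Prop := derivable (f : V -> R^o) x v.
Definition is_pd x v f (l : R) : Prop := is_derive x v (f : V -> R^o) (l : R^o).

Lemma is_derive_line f x v s : pdable f (s *: v + x) v ->
  is_derive (s : R^o) (1 : R^o) (fun t : R^o => f (t *: v + x) : R^o)
    (pd v f (s *: v + x)).
Proof.
move=> df.
have E : (fun h : R => h^-1 *: (((fun t : R^o => f (t *: v + x) : R^o) \o shift (s : R^o))
     (h *: (1 : R^o)) - (f (s *: v + x)))) =
     (fun h : R => h^-1 *: ((f \o shift (s *: v + x)) (h *: v) - f (s *: v + x))).
  by apply/funext => h /=; rewrite /shift /= scalerDl -addrA [h *: 1]mulr1.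
by split; rewrite ?pdE /derivable /derive /= E.
Qed.

(** Bounding c in absolute value lets one statement serve both signs of t; for t < 0 the theorem is
    applied on the segment from t to 0. *)
Lemma dir_MVT f x v t :
  (forall s, `|s| <= `|t| -> pdable f (s *: v + x) v) ->
  exists2 c, `|c| <= `|t| & f (t *: v + x) - f x = t * pd v f (c *: v + x).
Proof.
move=> df.
pose h (t : R) : R := f (t *: v + x).
pose dh (t : R) : R := pd v f (t *: v + x).
have dl s : `|s| <= `|t| -> is_derive s 1 h (dh s).
  by move=> st; apply: (@is_derive_line f x v s); exact: df.
have cont (a b : R) : (forall s, s \in `[a, b] -> `|s| <= `|t|) ->
    {within `[a, b], continuous h}.
  move=> ab; apply: derivable_within_continuous => s sab.
  by have [] := dl _ (ab _ sab).
have h0 : h 0 = f x by rewrite /h scale0r add0r.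
have [t0|t0] := leP 0 t.
  have I s : s \in `[0, t] -> `|s| <= `|t|.
    by rewrite in_itv /= => /andP[s0 st]; rewrite !ger0_norm.
  have [c cI E] := @MVT_segment R h dh 0 t t0
    (fun s sI => dl s (I s (subset_itv_oo_cc sI))) (cont 0 t I).
  exists c; first exact: I.
  by rewrite -h0 -[f _]/(h t) E subr0 mulrC.
have I s : s \in `[t, 0] -> `|s| <= `|t|.
  rewrite in_itv /= => /andP[st s0]; rewrite !ler0_norm ?lerN2//; exact: ltW.
have [c cI E] := @MVT_segment R h dh t 0 (ltW t0)
  (fun s sI => dl s (I s (subset_itv_oo_cc sI))) (cont t 0 I).
exists c; first exact: I.
by rewrite -h0 -[f _]/(h t) -[LHS]opprK opprB E sub0r mulrN opprK mulrC.
Qed.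

(** A small parallelogram at x stays inside the neighbourhood, so P holds at whatever intermediate
    points the mean value theorem returns. *)
Lemma near_seg2 (P : V -> Prop) x u v : (\forall y \near x, P y) ->
  \forall t \near (0 : R), forall s s', `|s| <= `|t| -> `|s'| <= `|t| ->
    P (s *: u + (s' *: v + x)).
Proof.
move=> /nbhs_ballP[e /= e0 eP].
(* The summand 1 keeps M positive when u and v are 0. *)
pose M := `|u| + `|v| + 1.
have M0 : 0 < M by rewrite /M ltr_wpDl// addr_ge0.
apply/nbhs_ballP; exists (e / M); first by rewrite /= divr_gt0.
move=> t; rewrite /ball /= sub0r normrN => tM s s' st s't.
apply: eP; rewrite -ball_normE /ball_ /= addrA opprD addrCA subrr addr0 normrN.
apply: (le_lt_trans (ler_normD _ _)); rewrite !normrZ.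
apply: (@le_lt_trans _ _ (`|t| * M)); last by rewrite -ltr_pdivlMr.
rewrite /M; have := ler_wpM2r (normr_ge0 u) st.
have := ler_wpM2r (normr_ge0 v) s't; have := normr_ge0 t; nra.
Qed.

Lemma near_seg1 (P : V -> Prop) x v : (\forall y \near x, P y) ->
  \forall t \near (0 : R), forall s, `|s| <= `|t| -> P (s *: v + x).
Proof.
move=> /(@near_seg2 _ x v 0); apply: filterS => t tP s st.
by have := tP s 0 st; rewrite normr0 scale0r add0r; apply.
Qed.

(** A form of the difference quotient without division; at t = 0 the bound reads 0 <= 0, so a full
    neighbourhood of 0 can be used. *)
Lemma is_pd_eps f x w l :
  (forall e, 0 < e -> \forall t \near (0 : R),
     `|f (t *: w + x) - f x - t * l| <= e * `|t|) ->
  is_pd x w f l.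
Proof.
move=> H.
have C : (fun h : R => h^-1 *: ((f \o shift x) (h *: w) - f x)) @ 0^' --> (l : R^o).
  apply/cvgrPdist_le => e e0; have := H e e0.
  rewrite !nearE => /nbhs_ballP[d /= d0 dP].
  apply/nbhs_ballP; exists d => //= t td t0.
  have := dP t td; rewrite /shift /= => E.
  rewrite -(ler_pM2r (_ : 0 < `|t|)) ?normr_gt0// (le_trans _ E)//.
  rewrite -normrM -[X in _ <= X]normrN [X in `|X| <= _](_ : _ =
    - (f (t *: w + x) - f x - t * l)) //.
  by rewrite -[_ *: _]/(t^-1 * _); field.
by split; [apply/cvg_ex; exists l | exact: cvg_lim C].
Qed.

Lemma pdZ_dir f x v c : (\forall y \near x, pdable f y v) ->
  {for x, continuous (pd v f)} ->
  is_pd x (c *: v) f (c * pd v f x).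
Proof.
move=> df cf; apply: is_pd_eps => e e0.
pose M := `|c| + 1.
have M0 : 0 < M by rewrite /M ltr_wpDl.
have eM : 0 < e / M by rewrite divr_gt0.
have /near_seg1 : \forall y \near x, pdable f y v /\ `|pd v f y - pd v f x| <= e / M.
  move/cvgrPdist_le : cf => /(_ _ eM) cf.
  by apply: filterS2 df cf => y yv; rewrite distrC => yc; exact: conj.
move=> /(_ (c *: v)); apply: filterS => t tP.
(* The known segments have direction c v, and s v = (s / c) (c v); for c = 0 only s = 0 occurs. *)
have tc : forall s, `|s| <= `|t * c| ->
    pdable f (s *: v + x) v /\ `|pd v f (s *: v + x) - pd v f x| <= e / M.
  move=> s; have [->|c0] := eqVneq c 0.
    rewrite mulr0 normr0 normr_le0 => /eqP ->.
    by have := tP 0; rewrite normr0 !scale0r !add0r; apply.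
  rewrite normrM -ler_pdivrMr ?normr_gt0// -normfV -normrM => sc.
  by have := tP (s / c) sc; rewrite scalerA divfK.
have [d dt E] := @dir_MVT f x v (t * c) (fun s st => proj1 (tc s st)).
rewrite scalerA E -mulrA -mulrBr normrM mulrC ler_wpM2r// -mulrBr normrM.
rewrite (le_trans (ler_wpM2l _ (tc d dt).2))//.
rewrite mulrCA ler_piMr ?(ltW e0)// ler_pdivrMr// mul1r /M lerDl//.
Qed.

(** The increment from x to x + t (u + v) is split at x + t v. The mean value theorem on each leg
    gives a derivative at a nearby point, which continuity compares with the one at x. *)
Lemma pdD_dir f x u v :
  (\forall y \near x, pdable f y u) -> (\forall y \near x, pdable f y v) ->
  {for x, continuous (pd u f)} ->
  {for x, continuous (pd v f)} ->
  is_pd x (u + v) f (pd u f x + pd v f x).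
Proof.
move=> du dv cu cv; apply: is_pd_eps => e e0.
have e2 : 0 < e / 2 by rewrite divr_gt0.
have /near_seg2 : \forall y \near x, [/\ pdable f y u, pdable f y v,
    `|pd u f y - pd u f x| <= e / 2 & `|pd v f y - pd v f x| <= e / 2].
  move/cvgrPdist_le : cu => /(_ _ e2) cu; move/cvgrPdist_le : cv => /(_ _ e2) cv.
  apply: filterS2 (filterI du dv) (filterI cu cv) => y [yu yv] [yu' yv'].
  rewrite distrC in yu'; rewrite distrC in yv'; exact (And4 yu yv yu' yv').
move=> /(_ u v); apply: filterS => t tP {du dv cu cv}.
have [|c ct Ec] := @dir_MVT f (t *: v + x) u t.
  by move=> s st; have [] := tP s t st (lexx _).
have [|d dt Ed] := @dir_MVT f x v t.
  move=> s st; have [//|_] := tP 0 s _ st; first by rewrite normr0.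
  by rewrite scale0r add0r.
have [_ _ Bu _] := tP c t ct (lexx _).
have [|_ _ _] := tP 0 d _ dt; first by rewrite normr0.
rewrite scale0r add0r => Bv.
have -> : f (t *: (u + v) + x) - f x - t * (pd u f x + pd v f x) =
   t * ((pd u f (c *: u + (t *: v + x)) - pd u f x) + (pd v f (d *: v + x) - pd v f x)).
  have -> : f (t *: (u + v) + x) - f x =
     (f (t *: u + (t *: v + x)) - f (t *: v + x)) + (f (t *: v + x) - f x).
    by rewrite scalerDr -addrA [RHS]addrA subrK.
  by rewrite Ec Ed -mulrDr -mulrBr [in RHS]addrACA opprD.
rewrite normrM mulrC ler_wpM2r// (le_trans (ler_normD _ _))// [leRHS]splitr.
exact: (lerD Bu Bv).
Qed.

Lemma pd_comm f x u v :
  (\forall y \near x, pdable f y u) -> (\forall y \near x, pdable f y v) ->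
  (\forall y \near x, pdable (pd v f) y u) ->
  (\forall y \near x, pdable (pd u f) y v) ->
  {for x, continuous (pd u (pd v f))} ->
  {for x, continuous (pd v (pd u f))} ->
  pd u (pd v f) x = pd v (pd u f) x.
Proof.
(* Both mixed derivatives are limits of the same second difference quotient. *)
pose Q (y w : V) (e t : R) : Prop :=
  `|f (t *: y + (t *: w + x)) - f (t *: y + x) - f (t *: w + x) + f x
      - t ^+ 2 * pd w (pd y f) x| <= e * t ^+ 2.
suff W (y w : V) : (\forall z \near x, pdable f z y) ->
    (\forall z \near x, pdable (pd y f) z w) ->
    {for x, continuous (pd w (pd y f))} ->
    forall e, 0 < e -> \forall t \near (0 : R), Q y w e t.
  move=> du dv duv dvu cuv cvu; apply/eqP; rewrite -subr_eq0 -normr_le0.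
  apply/ler_addgt0Pr => e e0; rewrite add0r.
  have e2 : 0 < e / 2 by rewrite divr_gt0.
  (* One nonzero t satisfying both estimates is enough: their difference bounds [t ^+ 2] times the
     gap between the mixed derivatives. *)
  have [t [t0 [At Bt]]] : exists t : R, t != 0 /\ Q v u (e / 2) t /\ Q u v (e / 2) t.
    have A := nbhs_dnbhs (W v u dv duv cuv _ e2).
    have B := nbhs_dnbhs (W u v du dvu cvu _ e2).
    by have [t [tn tA]] := filter_ex (filterI (nbhs_dnbhs_neq 0) (filterI A B)); exists t.
  move=> {du dv duv dvu cuv cvu W}.
  have t2 : 0 < t ^+ 2 by rewrite exprn_even_gt0.
  rewrite -(ler_pM2r t2) -[X in _ * X <= _]gtr0_norm// -normrM.
  rewrite [X in `|X|](_ : _ = (f (t *: u + (t *: v + x)) - f (t *: u + x) - f (t *: v + x) + f x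
        - t ^+ 2 * pd v (pd u f) x) -
   (f (t *: v + (t *: u + x)) - f (t *: v + x) - f (t *: u + x) + f x
        - t ^+ 2 * pd u (pd v f) x)); last first.
    rewrite [t *: u + (t *: v + x)]addrCA.
    move: (f _) (f _) (f _) (f x) (pd u _ x) (pd v _ x) => a b c d p q; ring.
  rewrite (le_trans (ler_normB _ _))// [in leRHS](splitr e) mulrDl; exact: (lerD Bt At).
move=> dy dw c e e0; rewrite /Q.
have /near_seg2 : \forall z \near x, [/\ pdable f z y,
    pdable (pd y f) z w &
    `|pd w (pd y f) z - pd w (pd y f) x| <= e].
  move/cvgrPdist_le : c => /(_ _ e0) c.
  apply: filterS2 (filterI dy dw) c => z [zy zw] zc.
  rewrite distrC in zc; exact (And3 zy zw zc).
move=> /(_ y w); apply: filterS => t tP {dy dw c}.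
(* The second difference is [g (t *: y + x) - g x]. The mean value theorem for g along y, then for
   [pd y f] along w, makes it [t ^+ 2] times a mixed derivative inside the parallelogram. *)
pose g z : R := f (t *: w + z) - f z.
have dft s : `|s| <= `|t| -> pdable f (s *: y + x) y.
  move=> st; have [|D _ _] := tP s 0 st; first by rewrite normr0.
  by rewrite scale0r add0r in D.
have dftw s : `|s| <= `|t| -> is_derive (s *: y + x) y (fun z => f (t *: w + z) : R^o)
   (pd y f (t *: w + (s *: y + x))).
  move=> st; have [D _ _] := tP s t st (lexx _).
  have E : (fun h : R => h^-1 *:
      (((fun z => f (t *: w + z) : R^o) \o shift (s *: y + x)) (h *: y)
        - f (t *: w + (s *: y + x)))) =
     (fun h : R => h^-1 *: ((f \o shift (t *: w + (s *: y + x))) (h *: y)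
        - f (t *: w + (s *: y + x)))).
    by apply/funext => h /=; rewrite /shift /= addrCA.
  by rewrite addrCA in D; split; rewrite ?pdE /derivable /derive /= E // addrCA.
have dg s : `|s| <= `|t| -> is_derive (s *: y + x) y g
   (pd y f (t *: w + (s *: y + x)) - pd y f (s *: y + x)).
  move=> st; apply: is_deriveB; first exact: dftw.
  by rewrite pdE; exact/derivableP/dft.
have [|d dt Ed] := @dir_MVT g x y t.
  by move=> s st; have [] := dg s st.
have [_ Ed'] := dg d dt; rewrite -pdE in Ed'.
have [|d' d't Ed''] := @dir_MVT (pd y f) (d *: y + x) w t.
  by move=> s st; have [_ + _] := tP d s dt st; rewrite addrCA.
have [_ _ B] := tP d d' dt d't.
rewrite [X in `|X|](_ : _ = (g (t *: y + x) - g x) - t ^+ 2 * pd w (pd y f) x); last first.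
  by rewrite /g [t *: w + (t *: y + x)]addrCA; ring.
rewrite Ed Ed' Ed'' mulrA -expr2 -mulrBr normrM ger0_norm ?sqr_ge0// mulrC.
rewrite [d *: y + _]addrCA in B; exact (ler_wpM2r (sqr_ge0 t) B).
Qed.

End DirectionalDerivatives.

(** * Smooth functions as functions of class C^k for every k *)

Section SmoothFunctions.
Context {R : realType} {V : normedModType R}.
Implicit Types (f g : V -> R) (x u v : V) (t s : R) (U : set V).

Lemma is_pd_pdable f x v l : is_pd x v f l -> pdable f x v.
Proof. by case. Qed.

Lemma is_pd_pd f x v l : is_pd x v f l -> pd v f x = l.
Proof. by case=> _ <-; rewrite pdE. Qed.

Lemma pdableP f x v : pdable f x v -> is_pd x v f (pd v f x).
Proof. by move=> df; rewrite pdE; apply: derivableP. Qed.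

Lemma is_pd_cst (c : R) x v : is_pd x v (fun=> c) 0.
Proof. exact: is_derive_cst. Qed.

Lemma is_pdD f g x v l m : is_pd x v f l -> is_pd x v g m ->
  is_pd x v (fun y => f y + g y) (l + m).
Proof. by move=> ? ?; apply: is_deriveD. Qed.

Lemma is_pdM f g x v l m : is_pd x v f l -> is_pd x v g m ->
  is_pd x v (fun y => f y * g y) (l * g x + f x * m).
Proof.
move=> df dg; rewrite /is_pd [X in is_derive _ _ _ X](_ : _ = f x *: (m : R^o) + g x *: (l : R^o)).
  exact: (@is_deriveM R V f g x v l m df dg).
by rewrite addrC [l * _]mulrC.
Qed.

Lemma is_pdV f x v l : f x != 0 -> is_pd x v f l ->
  is_pd x v (fun y => (f y)^-1) (- l * (f x)^-1 * (f x)^-1).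
Proof.
move=> f0 [df <-]; split; first exact: derivableV.
rewrite (deriveV f0 df) -[LHS]/(- (f x) ^- 2 * 'D_v (f : V -> R^o) x).
by rewrite -exprVn expr2 !mulNr mulrC mulrA.
Qed.

Lemma is_pd_eq f g x v l : (\forall y \near x, f y = g y) -> is_pd x v f l -> is_pd x v g l.
Proof. exact: near_eq_is_derive. Qed.

(** Recursion on the order replaces recursion on the list of directions: a product rule mixes a
    derivative of one factor with the other factor itself, and a common order for both makes the
    induction close. *)
Fixpoint Ck k U f : Prop :=
  (forall x, U x -> {for x, continuous f}) /\
  if k is k'.+1 then forall v, (forall x, U x -> pdable f x v) /\ Ck k' U (pd v f)
  else True.

Lemma CkE k U f : Ck k U f = ((forall x, U x -> {for x, continuous f}) /\
  if k is k'.+1 then forall v, (forall x, U x -> pdable f x v) /\ Ck k' U (pd v f)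
  else True).
Proof. by case: k. Qed.

Lemma pd_fun v f : (fun x => 'D_v (f : V -> R^o) x) = pd v f.
Proof. by apply/funext => x; rewrite pdE. Qed.

(** [iter_deriv] applies the last direction of the list first, so lists are built and analysed from
    their right end. *)
Lemma smooth_onP U f : smooth_on U (f : V -> R^o) <-> forall k, Ck k U f.
Proof.
split=> [sf k|H vs].
  elim: k f sf => [|k IH] f sf; rewrite CkE;
    (split; first by move=> x Ux; have [] := sf [::] x Ux); first by [].
  move=> v; split=> [x Ux|]; first by have [_] := sf [::] x Ux; apply.
  apply: IH => vs x Ux; have := sf (rcons vs v) x Ux.
  by rewrite /iter_deriv foldr_rcons pd_fun.
elim/last_ind: vs f H => [|vs v IH] f H x Ux.
  have := H 1%N; rewrite CkE => -[cf df].
  by split; [exact: cf | move=> v; have [+ _] := df v; apply].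
rewrite /iter_deriv foldr_rcons pd_fun; apply: IH Ux => k.
by have := H k.+1; rewrite CkE => -[_ /(_ v)[]].
Qed.

Lemma CkW k U f : Ck k.+1 U f -> Ck k U f.
Proof.
elim: k f => [|k IH] f; rewrite CkE => -[cf df]; rewrite CkE; split=> // v.
by have [dv Cv] := df v; split=> //; exact: IH.
Qed.

Lemma near_continuous f g x : (\forall y \near x, f y = g y) ->
  {for x, continuous f} -> {for x, continuous g}.
Proof.
move=> fg cf; have E : g x = f x by rewrite (nbhs_singleton fg).
have : f @ x --> g x by rewrite E.
by apply: cvg_trans; apply: near_eq_cvg.
Qed.

(** On an open set equality holds near each point, hence passes to derivatives. *)
Lemma eq_Ck k U f g : open U -> (forall x, U x -> f x = g x) -> Ck k U f -> Ck k U g.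
Proof.
move=> oU; elim: k f g => [|k IH] f g fg; rewrite !CkE => -[cf df].
all: have fgn x : U x -> \forall y \near x, f y = g y by
  move=> Ux; apply: filterS (open_nbhs_nbhs (conj oU Ux)) => y; exact: fg.
all: split; first by move=> x Ux; apply: near_continuous (fgn x Ux) (cf x Ux).
  by [].
move=> v; have [dv Cv] := df v.
have D x : U x -> is_pd x v g (pd v f x).
  by move=> Ux; apply: is_pd_eq (fgn x Ux) _; apply/pdableP/dv.
split=> [x Ux|]; first exact: is_pd_pdable (D x Ux).
by apply: IH Cv => x Ux; rewrite (is_pd_pd (D x Ux)).
Qed.

Lemma Ck_cst k U (c : R) : Ck k U (fun=> c).
Proof.
elim: k c => [|k IH] c; rewrite CkE; (split; first by move=> x _; exact: cvg_cst).
  by [].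
move=> v; split=> [x _|]; first exact: is_pd_pdable (is_pd_cst c x v).
by rewrite [pd _ _](_ : _ = fun=> 0) //; apply/funext => x; exact: is_pd_pd (is_pd_cst c x v).
Qed.

Lemma CkD k U f g : open U -> Ck k U f -> Ck k U g -> Ck k U (fun x => f x + g x).
Proof.
move=> oU; elim: k f g => [|k IH] f g; rewrite !CkE => -[cf df] [cg dg].
all: split; first by move=> x Ux; apply: (@cvgD R R); [exact: cf|exact: cg].
  by [].
move=> v; have [dfv Cfv] := df v; have [dgv Cgv] := dg v.
have D x : U x -> is_pd x v (fun y => f y + g y) (pd v f x + pd v g x).
  by move=> Ux; apply: is_pdD; apply: pdableP; [exact: dfv|exact: dgv].
split=> [x Ux|]; first exact: is_pd_pdable (D x Ux).
by apply: eq_Ck oU _ (IH _ _ Cfv Cgv) => x Ux; rewrite (is_pd_pd (D x Ux)).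
Qed.

Lemma CkM k U f g : open U -> Ck k U f -> Ck k U g -> Ck k U (fun x => f x * g x).
Proof.
move=> oU; elim: k f g => [|k IH] f g Cf Cg.
all: have := Cf; have := Cg; rewrite !CkE => -[cg dg] [cf df].
all: split; first by move=> x Ux; apply: (@cvgM R); [exact: cf|exact: cg].
  by [].
move=> v; have [dfv Cfv] := df v; have [dgv Cgv] := dg v.
have D x : U x -> is_pd x v (fun y => f y * g y) (pd v f x * g x + f x * pd v g x).
  by move=> Ux; apply: is_pdM; apply: pdableP; [exact: dfv|exact: dgv].
split=> [x Ux|]; first exact: is_pd_pdable (D x Ux).
apply: eq_Ck oU _ (CkD oU (IH _ _ Cfv (CkW Cg)) (IH _ _ (CkW Cf) Cgv)) => x Ux.
by rewrite (is_pd_pd (D x Ux)).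
Qed.

(** The derivative - f' / f^2 involves the inverse of f only to one order less, which the induction
    provides. *)
Lemma CkV k U f : open U -> (forall x, U x -> f x != 0) -> Ck k U f ->
  Ck k U (fun x => (f x)^-1).
Proof.
move=> oU f0; elim: k => [|k IH] Cf; have := Cf; rewrite !CkE => -[cf df].
all: split; first by move=> x Ux; apply: (@cvgV R); [exact: f0|exact: cf].
  by [].
move=> v; have [dfv Cfv] := df v; have IH' := IH (CkW Cf).
have D x : U x -> is_pd x v (fun y => (f y)^-1) (- pd v f x * (f x)^-1 * (f x)^-1).
  by move=> Ux; apply: is_pdV (f0 x Ux) _; apply: pdableP; exact: dfv.
split=> [x Ux|]; first exact: is_pd_pdable (D x Ux).
apply: eq_Ck oU _ (CkM oU (CkM oU (CkM oU (Ck_cst k U (-1)) Cfv) IH') IH') => x Ux.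
by rewrite (is_pd_pd (D x Ux)) mulN1r.
Qed.

Lemma is_pd_linear f x v : (forall a u w, f (a *: u + w) = a * f u + f w) ->
  is_pd x v f (f v).
Proof.
move=> lf; apply: is_pd_eps => e e0; near=> t.
by rewrite lf addrK subrr normr0 mulr_ge0// ltW.
Unshelve. all: by end_near. Qed.

Lemma Ck_linear k U f : (forall a u v, f (a *: u + v) = a * f u + f v) ->
  continuous f -> Ck k U f.
Proof.
move=> lf cf; rewrite CkE; split; first by move=> x _; exact: cf.
case: k => // k v; split=> [x _|]; first exact: is_pd_pdable (is_pd_linear x v lf).
rewrite (_ : pd v f = fun=> f v); first exact: Ck_cst.
by apply/funext => x; exact: is_pd_pd (is_pd_linear x v lf).
Qed.

End SmoothFunctions.

(** * Quaternionic matrices *)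

Section QuaternionicAlgebra.
Context {R : realType}.

Lemma addmxE m n (A B : 'M[R]_(m, n)) i j : (A + B) i j = A i j + B i j.
Proof. by rewrite mxE. Qed.
Lemma oppmxE m n (A : 'M[R]_(m, n)) i j : (- A) i j = - A i j.
Proof. by rewrite mxE. Qed.

Ltac mx_abelian := apply/matrixP => i j; rewrite ?(addmxE, oppmxE); ring.

Lemma qmulA m n p q (A : qmx R m n) (B : qmx R n p) (C : qmx R p q) :
  qmul A (qmul B C) = qmul (qmul A B) C.
Proof.
move: A B C => [[[a0 a1] a2] a3] [[[b0 b1] b2] b3] [[[c0 c1] c2] c3].
rewrite /qmul /qre /qimi /qimj /qimk /=; congr (_, _, _, _);
rewrite !(mulmxDl, mulmxDr, mulmxBl, mulmxBr, mulmxN, mulNmx, mulmxA);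
mx_abelian.
Qed.

Lemma qmulDl m n p (A A' : qmx R m n) (B : qmx R n p) :
  qmul (A + A') B = qmul A B + qmul A' B.
Proof.
move: A A' B => [[[a0 a1] a2] a3] [[[a0' a1'] a2'] a3'] [[[b0 b1] b2] b3].
rewrite /qmul /qre /qimi /qimj /qimk /=; congr (_, _, _, _);
rewrite !mulmxDl; mx_abelian.
Qed.

Lemma qmulDr m n p (A : qmx R m n) (B B' : qmx R n p) :
  qmul A (B + B') = qmul A B + qmul A B'.
Proof.
move: A B B' => [[[a0 a1] a2] a3] [[[a0' a1'] a2'] a3'] [[[b0 b1] b2] b3].
rewrite /qmul /qre /qimi /qimj /qimk /=; congr (_, _, _, _);
rewrite !mulmxDr; mx_abelian.
Qed.

Lemma qmulZl m n p c (A : qmx R m n) (B : qmx R n p) :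
  qmul (c *: A) B = c *: qmul A B.
Proof.
move: A B => [[[a0 a1] a2] a3] [[[b0 b1] b2] b3].
rewrite /qmul /qre /qimi /qimj /qimk /=; congr (_, _, _, _);
by rewrite -!scalemxAl !(scalerDr, scalerN).
Qed.

Lemma qmulZr m n p c (A : qmx R m n) (B : qmx R n p) :
  qmul A (c *: B) = c *: qmul A B.
Proof.
move: A B => [[[a0 a1] a2] a3] [[[b0 b1] b2] b3].
rewrite /qmul /qre /qimi /qimj /qimk /=; congr (_, _, _, _);
by rewrite -!scalemxAr !(scalerDr, scalerN).
Qed.

Lemma qmul0l m n p (B : qmx R n p) : qmul (0 : qmx R m n) B = 0.
Proof. by rewrite -[X in qmul X _](scale0r (0 : qmx R m n)) qmulZl scale0r. Qed.

Lemma qmul0r m n p (A : qmx R m n) : qmul A (0 : qmx R n p) = 0.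
Proof. by rewrite -[X in qmul _ X](scale0r (0 : qmx R n p)) qmulZr scale0r. Qed.

Lemma qmulNl m n p (A : qmx R m n) (B : qmx R n p) : qmul (- A) B = - qmul A B.
Proof. by rewrite -scaleN1r qmulZl scaleN1r. Qed.

Lemma qmulNr m n p (A : qmx R m n) (B : qmx R n p) : qmul A (- B) = - qmul A B.
Proof. by rewrite -scaleN1r qmulZr scaleN1r. Qed.

Lemma qmul1l m n (A : qmx R m n) : qmul (qone m) A = A.
Proof.
move: A => [[[a0 a1] a2] a3]; rewrite /qmul /qre /qimi /qimj /qimk /=.
by rewrite !mul0mx !mul1mx !(subr0, addr0).
Qed.

Lemma qmul1r m n (A : qmx R m n) : qmul A (qone n) = A.
Proof.
move: A => [[[a0 a1] a2] a3]; rewrite /qmul /qre /qimi /qimj /qimk /=.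
by rewrite !mulmx0 !mulmx1 !(subr0, addr0, add0r).
Qed.

Definition retr m (A : qmx R m m) : R := \tr (qre A).

Lemma retrD m (A B : qmx R m m) : retr (A + B) = retr A + retr B.
Proof. exact: mxtraceD. Qed.

Lemma retrZ m c (A : qmx R m m) : retr (c *: A) = c * retr A.
Proof. exact: mxtraceZ. Qed.

Lemma retrN m (A : qmx R m m) : retr (- A) = - retr A.
Proof. by rewrite -scaleN1r retrZ mulN1r. Qed.

(** Only the real part of a quaternionic trace is cyclic: it pairs equal components of A and B, and
    each such term is an ordinary real trace. *)
Lemma retr_mulC m n (A : qmx R m n) (B : qmx R n m) :
  retr (qmul A B) = retr (qmul B A).
Proof.
move: A B => [[[a0 a1] a2] a3] [[[b0 b1] b2] b3].
rewrite /retr /qmul /qre /qimi /qimj /qimk /=.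
rewrite !(mxtraceD, raddfN) /= (mxtrace_mulC a0) (mxtrace_mulC a1).
by rewrite (mxtrace_mulC a2) (mxtrace_mulC a3).
Qed.

Lemma qinverse_uniq m (A B C : qmx R m m) : qinverse A B -> qinverse A C -> B = C.
Proof. by move=> [AB BA] [aC Ca]; rewrite -[B]qmul1r -aC qmulA BA qmul1l. Qed.

Lemma qinverse_sym m (A B : qmx R m m) : qinverse A B -> qinverse B A.
Proof. by case. Qed.

Lemma qinverseM m (A A' B B' : qmx R m m) : qinverse A A' -> qinverse B B' ->
  qinverse (qmul A B) (qmul B' A').
Proof.
move=> [AV VA] [BV VB]; split.
  by rewrite -qmulA [qmul B _]qmulA BV qmul1l.
by rewrite -qmulA [qmul A' _]qmulA VA qmul1l.
Qed.

Lemma qinverseZ m c (A A' : qmx R m m) : c != 0 -> qinverse A A' ->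
  qinverse (c *: A) (c^-1 *: A').
Proof.
move=> c0 [AV VA]; split; rewrite qmulZl qmulZr scalerA ?AV ?VA.
  by rewrite divff // scale1r.
by rewrite mulVf // scale1r.
Qed.

Lemma GLHM m (A B : qmx R m m) : GLH A -> GLH B -> GLH (qmul A B).
Proof. by move=> [A' AA'] [B' BB']; exists (qmul B' A'); exact: qinverseM. Qed.

Lemma GLHZ m c (A : qmx R m m) : c != 0 -> GLH A -> GLH (c *: A).
Proof. by move=> c0 [A' AA']; exists (c^-1 *: A'); exact: qinverseZ. Qed.

Lemma qmul_block m1 m2 n1 n2 p1 p2
  (a : qmx R m1 n1) (b : qmx R m1 n2) (c : qmx R m2 n1) (d : qmx R m2 n2)
  (a' : qmx R n1 p1) (b' : qmx R n1 p2) (c' : qmx R n2 p1) (d' : qmx R n2 p2) :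
  qmul (qblock a b c d) (qblock a' b' c' d') =
  qblock (qmul a a' + qmul b c') (qmul a b' + qmul b d')
         (qmul c a' + qmul d c') (qmul c b' + qmul d d').
Proof.
move: a b c d a' b' c' d' =>
  [[[a0 a1] a2] a3] [[[b0 b1] b2] b3] [[[c0 c1] c2] c3] [[[d0 d1] d2] d3]
  [[[a0' a1'] a2'] a3'] [[[b0' b1'] b2'] b3'] [[[c0' c1'] c2'] c3'] [[[d0' d1'] d2'] d3'].
rewrite /qmul /qblock /qre /qimi /qimj /qimk /= !mulmx_block !opp_block_mx !add_block_mx.
congr (_, _, _, _); congr (block_mx _ _ _ _); mx_abelian.
Qed.

Lemma qblockD m1 m2 n1 n2
  (a : qmx R m1 n1) (b : qmx R m1 n2) (c : qmx R m2 n1) (d : qmx R m2 n2) a' b' c' d' :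
  qblock a b c d + qblock a' b' c' d' = qblock (a + a') (b + b') (c + c') (d + d').
Proof. by rewrite /qblock; congr (_, _, _, _); rewrite add_block_mx. Qed.

Lemma qblockZ m1 m2 n1 n2 k
  (a : qmx R m1 n1) (b : qmx R m1 n2) (c : qmx R m2 n1) (d : qmx R m2 n2) :
  k *: qblock a b c d = qblock (k *: a) (k *: b) (k *: c) (k *: d).
Proof. by rewrite /qblock; congr (_, _, _, _); rewrite scale_block_mx. Qed.

Lemma qblock_inj m1 m2 n1 n2
  (a : qmx R m1 n1) (b : qmx R m1 n2) (c : qmx R m2 n1) (d : qmx R m2 n2) a' b' c' d' :
  qblock a b c d = qblock a' b' c' d' -> [/\ a = a', b = b', c = c' & d = d'].
Proof.
move: a b c d a' b' c' d' =>
  [[[a0 a1] a2] a3] [[[b0 b1] b2] b3] [[[c0 c1] c2] c3] [[[d0 d1] d2] d3]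
  [[[a0' a1'] a2'] a3'] [[[b0' b1'] b2'] b3'] [[[c0' c1'] c2'] c3'] [[[d0' d1'] d2'] d3'].
rewrite /qblock /qre /qimi /qimj /qimk /= => -[].
by do 4![move=> /eq_block_mx[-> -> -> ->]].
Qed.

Lemma qblockN m1 m2 n1 n2
  (a : qmx R m1 n1) (b : qmx R m1 n2) (c : qmx R m2 n1) (d : qmx R m2 n2) :
  - qblock a b c d = qblock (- a) (- b) (- c) (- d).
Proof. by rewrite -scaleN1r qblockZ !scaleN1r. Qed.

Lemma qblock0 m1 m2 n1 n2 :
  qblock 0 0 0 0 = 0 :> qmx R (m1 + m2) (n1 + n2).
Proof. by rewrite /qblock !block_mx0. Qed.

Lemma qblock1 m1 m2 : qblock (qone m1) 0 0 (qone m2) = qone (m1 + m2) :> qmx R _ _.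
Proof. by rewrite /qblock /qone /qre /qimi /qimj /qimk /= -scalar_mx_block !block_mx0. Qed.

Lemma qblockP m1 m2 n1 n2 (A : qmx R (m1 + m2) (n1 + n2)) :
  exists a b c d, A = qblock a b c d.
Proof.
move: A => [[[a0 a1] a2] a3].
exists (ulsubmx a0, ulsubmx a1, ulsubmx a2, ulsubmx a3),
  (ursubmx a0, ursubmx a1, ursubmx a2, ursubmx a3),
  (dlsubmx a0, dlsubmx a1, dlsubmx a2, dlsubmx a3),
  (drsubmx a0, drsubmx a1, drsubmx a2, drsubmx a3).
by rewrite /qblock /qre /qimi /qimj /qimk /= !submxK.
Qed.

Lemma retr_block m1 m2 (a : qmx R m1 m1) b c (d : qmx R m2 m2) :
  retr (qblock a b c d) = retr a + retr d.
Proof. exact: mxtrace_block. Qed.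

End QuaternionicAlgebra.

(** Packs a proof of linearity into the structure that [lfunE] expects, for maps given as bare
    functions. *)
Lemma linfunE (K : fieldType) (aT rT : vectType K) (f : aT -> rT) :
  linear f -> linfun f =1 f.
Proof.
move=> lf; pose L := GRing.isLinear.Build K aT rT _ f lf.
by move=> x; rewrite -[f in LHS]/(HB.pack_for {linear aT -> rT} f L : aT -> rT) lfunE.
Qed.

Section ContinuousSums.
Context {R : realType} {T : topologicalType}.

Lemma continuous_bigsum (I : Type) (r : seq I) (P : pred I) (F : I -> T -> R) :
  (forall i, continuous (F i)) -> continuous (fun x => \sum_(i <- r | P i) F i x).
Proof.
move=> cF; elim: r => [|i r IH] x.
  by rewrite (_ : (fun _ => _) = fun=> 0); [exact: cvg_cst | apply/funext => y; rewrite big_nil].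
rewrite (_ : (fun _ => _) =
    fun y => (if P i then F i y else 0) + \sum_(i <- r | P i) F i y); last first.
  by apply/funext => y; rewrite big_cons; case: ifP => //; rewrite add0r.
apply: (@cvgD R R); last exact: IH.
by case: (P i); [exact: cF | exact: cvg_cst].
Qed.

Lemma continuous_bigprod (I : Type) (r : seq I) (F : I -> T -> R) :
  (forall i, continuous (F i)) -> continuous (fun x => \prod_(i <- r) F i x).
Proof.
move=> cF; elim: r => [|i r IH] x.
  by rewrite (_ : (fun _ => _) = fun=> 1); [exact: cvg_cst | apply/funext => y; rewrite big_nil].
rewrite (_ : (fun _ => _) = fun y => F i y * \prod_(i <- r) F i y); last first.
  by apply/funext => y; rewrite big_cons.
by apply: (@cvgM R); [exact: cF | exact: IH].
Qed.

Lemma continuous_det n (M : T -> 'M[R]_n) :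
  (forall i j, continuous (fun x => M x i j)) -> continuous (fun x => \det (M x)).
Proof.
move=> cM; rewrite /determinant; apply: continuous_bigsum => s x.
apply: (@cvgM R); first exact: cvg_cst.
exact: (@continuous_bigprod _ (index_enum 'I_n) (fun i x => M x i (s i))
  (fun i => cM i (s i)) x).
Qed.

End ContinuousSums.

Lemma continuous_proj4 (T1 T2 T3 T4 : topologicalType) :
  (continuous (fun A : T1 * T2 * T3 * T4 => A.1.1.1) /\
   continuous (fun A : T1 * T2 * T3 * T4 => A.1.1.2)) /\
  (continuous (fun A : T1 * T2 * T3 * T4 => A.1.2) /\
   continuous (fun A : T1 * T2 * T3 * T4 => A.2)).
Proof.
have c1 (U V : topologicalType) : continuous (@fst U V) by move=> x; exact: cvg_fst.
have c2 (U V : topologicalType) : continuous (@snd U V) by move=> x; exact: cvg_snd.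
split; split => A.
- exact: (continuous_comp (continuous_comp (c1 _ _ A) (c1 _ _ _)) (c1 _ _ _)).
- exact: (continuous_comp (continuous_comp (c1 _ _ A) (c1 _ _ _)) (c2 _ _ _)).
- exact: (continuous_comp (c1 _ _ A) (c2 _ _ _)).
- exact: c2.
Qed.

(** * Real coordinates on quaternionic matrices; GL(m, H) is open *)

Section QuaternionicTopology.
Context {R : realType}.

Definition qiota m n (t : 'I_4) (a : 'M[R]_(m, n)) : qmx R m n :=
  match nat_of_ord t with
  | 0%N => (a, 0, 0, 0) | 1%N => (0, a, 0, 0) | 2%N => (0, 0, a, 0) | _ => (0, 0, 0, a)
  end.

Definition qcomp m n (t : 'I_4) (A : qmx R m n) : 'M[R]_(m, n) :=
  match nat_of_ord t with
  | 0%N => qre A | 1%N => qimi A | 2%N => qimj A | _ => qimk A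
  end.

Lemma sum4 (V : zmodType) (F : 'I_4 -> V) :
  \sum_i F i = F (inord 0) + F (inord 1) + F (inord 2) + F (inord 3).
Proof.
rewrite !big_ord_recl big_ord0 addr0 !addrA.
by congr (F _ + F _ + F _ + F _); apply/val_inj; rewrite /= inordK.
Qed.

Lemma qcomp_sum m n (A : qmx R m n) : A = \sum_t qiota t (qcomp t A).
Proof.
rewrite sum4 /qiota /qcomp !inordK //.
move: A => [[[a0 a1] a2] a3]; rewrite /qre /qimi /qimj /qimk /=.
by congr (_, _, _, _); rewrite /= ?addr0 ?add0r.
Qed.

Lemma qcomp_linear m n t : linear (@qcomp m n t).
Proof. by move=> a A B; rewrite /qcomp; case: t => -[|[|[|k]]]. Qed.

Lemma qiota_linear m n t : linear (@qiota m n t).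
Proof.
move=> a A B; rewrite /qiota; case: t => -[|[|[|k]]] i /=;
by congr (_, _, _, _); rewrite /= ?scaler0 ?addr0.
Qed.

Lemma continuous_qcomp m n t : continuous (@qcomp m.+1 n.+1 t).
Proof.
have [[c0 c1] [c2 c3]] := continuous_proj4 'M[R]_(m.+1, n.+1) 'M[R]_(m.+1, n.+1)
  'M[R]_(m.+1, n.+1) 'M[R]_(m.+1, n.+1).
by case: t => -[|[|[|k]]] i; [exact: c0 | exact: c1 | exact: c2 | exact: c3].
Qed.

Lemma qmx_sum m n (A : qmx R m n) :
  A = \sum_t \sum_i \sum_j qcomp t A i j *: qiota t (delta_mx i j).
Proof.
rewrite [LHS]qcomp_sum; apply: eq_bigr => t _.
rewrite {1}[qcomp t A]matrix_sum_delta.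
rewrite (big_morph (qiota t) (id1 := 0) (op1 := +%R)); first last.
- by have := @qiota_linear m n t (-1) 0 0; rewrite scaler0 addr0 scaleN1r addNr.
- by move=> x y; have := @qiota_linear m n t 1 x y; rewrite !scale1r.
apply: eq_bigr => i _.
rewrite (big_morph (qiota t) (id1 := 0) (op1 := +%R)); first last.
- by have := @qiota_linear m n t (-1) 0 0; rewrite scaler0 addr0 scaleN1r addNr.
- by move=> x y; have := @qiota_linear m n t 1 x y; rewrite !scale1r.
apply: eq_bigr => j _.
by have := @qiota_linear m n t (qcomp t A i j) (delta_mx i j) 0; rewrite !addr0 => ->;
  rewrite -[X in _ + X = _](_ : 0 = _) ?addr0 // /qiota; case: t => -[|[|[|k]]].
Qed.

Lemma linear_continuous_qmx m n (f : qmx R m.+1 n.+1 -> R) :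
  (forall a u v, f (a *: u + v) = a * f u + f v) -> continuous f.
Proof.
move=> lf.
have f0 : f 0 = 0.
  by have := lf (-1) 0 0; rewrite scaler0 addr0 mulN1r addNr.
have fD u v : f (u + v) = f u + f v by have := lf 1 u v; rewrite scale1r mul1r.
have fZ a u : f (a *: u) = a * f u by have := lf a u 0; rewrite !addr0 f0 addr0.
rewrite (_ : f = fun A => \sum_t \sum_i \sum_j
    qcomp t A i j * f (qiota t (delta_mx i j))); last first.
  apply/funext => A; rewrite {1}[A]qmx_sum (big_morph f fD f0); apply: eq_bigr => t _.
  rewrite (big_morph f fD f0); apply: eq_bigr => i _.
  by rewrite (big_morph f fD f0); apply: eq_bigr => j _; rewrite fZ.
do 3!apply: continuous_bigsum => ?; move=> x.
apply: (@cvgM R); last exact: cvg_cst.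
apply: (@continuous_comp _ _ _ (qcomp _) (fun M : 'M[R]_(m.+1, n.+1) => M _ _)).
  exact: continuous_qcomp.
exact: coord_continuous.
Qed.

Lemma qmul_linear m n p (A : qmx R m n) : linear (@qmul R m n p A).
Proof. by move=> a u v; rewrite qmulDr qmulZr. Qed.

(** An injective endomorphism of a finite-dimensional space is onto, which gives B with A B = 1;
    then A (B A) = A, and injectivity gives B A = 1. *)
Lemma GLH_lker m (A : qmx R m m) :
  GLH A <-> lker (linfun (@qmul R m m m A)) == 0%VS.
Proof.
have E := linfunE (@qmul_linear m m m A).
split=> [[B [AB BA]]|kA].
  apply/lker0P => x y; rewrite !E => xy.
  by rewrite -[x]qmul1l -[y]qmul1l -BA -!qmulA xy.
have AB : qmul A (((linfun (@qmul R m m m A))^-1)%VF (qone m)) = qone m.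
  by rewrite -[LHS]E lker0_lfunVK.
exists (((linfun (@qmul R m m m A))^-1)%VF (qone m)); split => //.
by move/lker0P: kA => inj; apply: inj; rewrite !E qmulA AB qmul1l qmul1r.
Qed.

Import VectorInternalTheory.

Lemma lker0_det (aT : vectType R) (f : 'End(aT)) :
  (lker f == 0%VS) = (\det (f2mx f) != 0).
Proof.
have fE x : f x = r2v (v2r x *m f2mx f).
  by rewrite unlock.
rewrite -unitfE -[RHS]/(f2mx f \in unitmx) -row_free_unit.
apply/idP/idP => [/lker0P fi|fr].
  apply: inj_row_free => v vf; apply: r2v_inj; apply: fi.
  by rewrite !fE !r2vK vf mul0mx.
apply/lker0P => x y; rewrite !fE => /r2v_inj.
by move=> /(row_free_inj fr)/v2r_inj.
Qed.

Lemma v2r_comb (vT : vectType R) a (x y : vT) :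
  v2r (a *: x + y) =
  a *: v2r x + v2r y.
Proof. by rewrite linearP. Qed.

(** Invertibility is the nonvanishing of the real determinant of left multiplication by A, whose
    matrix entries are linear in A. *)
Lemma open_GLH m : open (@GLH R m.+1).
Proof.
have -> : @GLH R m.+1 = [set A | \det (f2mx (linfun (@qmul R m.+1 m.+1 m.+1 A))) != 0].
  apply/seteqP; split=> A /=; by rewrite -lker0_det => /GLH_lker.
apply: (@open_comp _ _ _ [set x : R | x != 0]); last exact: open_neq.
move=> A _; apply: continuous_det => i j {A}.
apply: linear_continuous_qmx => a u v.
rewrite unlock /= !mxE /= qmulDl qmulZl (v2r_comb a) !mxE.
by [].
Qed.

End QuaternionicTopology.

(** * Smooth functions on open sets of matrices *)

Section SmoothOn.
Context {R : realType} {V : normedModType R} (U : set V).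
Context (oU : open U).
Implicit Types (f g : V -> R) (x u v : V).

Lemma smooth_cst (c : R) : smooth_on U (fun=> c : R^o).
Proof. by apply/smooth_onP => k; exact: Ck_cst. Qed.

Lemma smoothD f g : smooth_on U (f : V -> R^o) -> smooth_on U (g : V -> R^o) ->
  smooth_on U (fun x => f x + g x : R^o).
Proof. by move=> /smooth_onP Cf /smooth_onP Cg; apply/smooth_onP => k; exact: CkD. Qed.

Lemma smoothM f g : smooth_on U (f : V -> R^o) -> smooth_on U (g : V -> R^o) ->
  smooth_on U (fun x => f x * g x : R^o).
Proof. by move=> /smooth_onP Cf /smooth_onP Cg; apply/smooth_onP => k; exact: CkM. Qed.

Lemma smoothV f : (forall x, U x -> f x != 0) -> smooth_on U (f : V -> R^o) ->
  smooth_on U (fun x => (f x)^-1 : R^o).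
Proof. by move=> f0 /smooth_onP Cf; apply/smooth_onP => k; exact: CkV. Qed.

Lemma smooth_sum (I : Type) (r : seq I) (F : I -> V -> R) :
  (forall i, smooth_on U (F i : V -> R^o)) ->
  smooth_on U (fun x => \sum_(i <- r) F i x : R^o).
Proof.
move=> sF; elim: r => [|i r IH].
  rewrite (_ : (fun _ => _) = fun=> 0); first exact: smooth_cst.
  by apply/funext => y; rewrite big_nil.
rewrite (_ : (fun _ => _) = fun y => F i y + \sum_(i <- r) F i y); first exact: (smoothD (sF i) IH).
by apply/funext => y; rewrite big_cons.
Qed.

Lemma eq_smooth f g : (forall x, U x -> f x = g x) ->
  smooth_on U (f : V -> R^o) -> smooth_on U (g : V -> R^o).
Proof. by move=> fg /smooth_onP Cf; apply/smooth_onP => k; exact: eq_Ck (Cf k). Qed.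

Lemma smooth_pd f v : smooth_on U (f : V -> R^o) -> smooth_on U (pd v f : V -> R^o).
Proof.
move=> /smooth_onP Cf; apply/smooth_onP => k.
by have := Cf k.+1; rewrite CkE => -[_ /(_ v)[]].
Qed.

Lemma smooth_is_pd f x v : smooth_on U (f : V -> R^o) -> U x -> is_pd x v f (pd v f x).
Proof. by move=> sf Ux; apply: pdableP; have [_] := sf [::] x Ux; apply. Qed.

Lemma smooth_cvg f x : smooth_on U (f : V -> R^o) -> U x -> {for x, continuous f}.
Proof. by move=> sf Ux; have [] := sf [::] x Ux. Qed.

Lemma near_open (P : V -> Prop) x : U x -> (forall y, U y -> P y) -> \forall y \near x, P y.
Proof. by move=> Ux UP; apply: filterS (open_nbhs_nbhs (conj oU Ux)). Qed.

Lemma smooth_pd_linear f x : smooth_on U (f : V -> R^o) -> U x ->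
  forall a u v, pd (a *: u + v) f x = a * pd u f x + pd v f x.
Proof.
move=> sf Ux a u v.
have pdn w : \forall y \near x, pdable f y w.
  by apply: near_open Ux _ => y Uy; apply: is_pd_pdable (smooth_is_pd w sf Uy).
have c w : {for x, continuous (pd w f)} := smooth_cvg (smooth_pd w sf) Ux.
have Z : pd (a *: u) f x = a * pd u f x := is_pd_pd (pdZ_dir a (pdn u) (c u)).
by rewrite (is_pd_pd (pdD_dir (pdn (a *: u)) (pdn v) (c _) (c v))) Z.
Qed.

Lemma smooth_pdC f x u v : smooth_on U (f : V -> R^o) -> U x ->
  pd u (pd v f) x = pd v (pd u f) x.
Proof.
move=> sf Ux; have pdn g w : smooth_on U (g : V -> R^o) -> \forall y \near x, pdable g y w.
  by move=> sg; apply: near_open Ux _ => y Uy; apply: is_pd_pdable (smooth_is_pd w sg Uy).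
have sd w := smooth_pd w sf.
exact (pd_comm (pdn f u sf) (pdn f v sf) (pdn _ u (sd v)) (pdn _ v (sd u))
  (smooth_cvg (smooth_pd u (sd v)) Ux) (smooth_cvg (smooth_pd v (sd u)) Ux)).
Qed.

Lemma eq_pd f g x v : U x -> (forall y, U y -> f y = g y) -> pdable f x v -> pd v f x = pd v g x.
Proof.
by move=> Ux fg df; apply/esym/is_pd_pd/(is_pd_eq (near_open Ux fg))/pdableP.
Qed.

Lemma is_pd_sum x v (I : Type) (r : seq I) (F : I -> V -> R) (l : I -> R) :
  (forall i, is_pd x v (F i) (l i)) ->
  is_pd x v (fun y => \sum_(i <- r) F i y) (\sum_(i <- r) l i).
Proof.
move=> dF; elim: r => [|i r IH].
  rewrite big_nil (_ : (fun _ => _) = fun=> 0); first exact: is_pd_cst.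
  by apply/funext => y; rewrite big_nil.
rewrite big_cons (_ : (fun _ => _) = fun y => F i y + \sum_(i <- r) F i y).
  exact: (is_pdD (dF i) IH).
by apply/funext => y; rewrite big_cons.
Qed.

End SmoothOn.

(** * Changes of variable and left-invariant fields on matrices *)

Section LinearChange.
Context {R : realType} {V W : normedModType R}.

(** Both sides are the limit of one and the same difference quotient. Later L is scaling by a real
    number or right multiplication by an element of GL(n+1, H). *)
Lemma pd_comp_linear (L : V -> W) (f : W -> R) x v :
  (forall a u w, L (a *: u + w) = a *: L u + L w) ->
  pd v (f \o L) x = pd (L v) f (L x).
Proof.
move=> lL; rewrite !pdE /derive.
have E : (fun h : R => h^-1 *: (((f \o L : V -> R^o) \o shift x) (h *: v) - (f \o L) x)) =
  (fun h : R => h^-1 *: (((f : W -> R^o) \o shift (L x)) (h *: L v) - f (L x))).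
  by apply/funext => h; rewrite /= /shift /= lL.
by rewrite E.
Qed.

End LinearChange.

Section QuaternionicSmooth.
Context {R : realType} {n : nat}.
Local Notation gl := (qmx R n.+1 n.+1).
Context (U : set gl) (oU : open U).
Implicit Types (f g : gl -> R) (A u v : gl).

Lemma smooth_linear f : (forall a u v, f (a *: u + v) = a * f u + f v) ->
  smooth_on U (f : gl -> R^o).
Proof.
by move=> lf; apply/smooth_onP => k; apply: Ck_linear lf (linear_continuous_qmx lf).
Qed.

Let b := vbasis {: gl}.
(** Separates the direction from the derivatives along a fixed basis, so that a direction depending
    on A can itself be differentiated. *)
Lemma pd_coord f A w : smooth_on U (f : gl -> R^o) -> U A ->
  pd w f A = \sum_k coord b k w * pd b`_k f A.
Proof.
move=> sf UA; have lf := smooth_pd_linear oU sf UA.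
have f0 : pd 0 f A = 0.
  by have := lf (-1) 0 0; rewrite scaler0 addr0 mulN1r addNr.
have fD u v : pd (u + v) f A = pd u f A + pd v f A.
  by have := lf 1 u v; rewrite scale1r mul1r.
rewrite {1}(coord_vbasis (memvf w)) (big_morph (fun w => pd w f A) fD f0).
by apply: eq_bigr => k _; have := lf (coord b k w) b`_k 0; rewrite !addr0 f0 addr0.
Qed.

Lemma coord_lin k (L : gl -> gl) : linear L ->
  forall a u v, coord b k (L (a *: u + v)) = a * coord b k (L u) + coord b k (L v).
Proof. by move=> lL a u v; rewrite lL linearP. Qed.

Lemma qmulr_linear m k p (v : qmx R k p) : linear (fun A : qmx R m k => qmul A v).
Proof. by move=> a x y; rewrite qmulDl qmulZl. Qed.

Lemma smooth_pd_qmul f v : smooth_on U (f : gl -> R^o) ->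
  smooth_on U (fun A => pd (qmul A v) f A : R^o).
Proof.
move=> sf.
apply: (@eq_smooth _ _ _ oU (fun A => \sum_k coord b k (qmul A v) * pd b`_k f A)).
  by move=> A UA; rewrite -pd_coord.
apply: (smooth_sum oU) => k; apply: (smoothM oU).
  by apply: smooth_linear; apply: coord_lin; exact: qmulr_linear.
exact (smooth_pd b`_k sf).
Qed.

(** The product rule in the basis expansion: the first term comes from the motion of the direction B
    v with B, the sum is the second derivative of f in the directions w and A v. *)
Lemma pd_pd_qmul f A v w : smooth_on U (f : gl -> R^o) -> U A ->
  pd w (fun B => pd (qmul B v) f B) A =
  pd (qmul w v) f A + \sum_k coord b k (qmul A v) * pd w (pd b`_k f) A.
Proof.
move=> sf UA.
have D : is_pd A w (fun A => \sum_k coord b k (qmul A v) * pd b`_k f A)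
   (\sum_k (coord b k (qmul w v) * pd b`_k f A
      + coord b k (qmul A v) * pd w (pd b`_k f) A)).
  apply: is_pd_sum => k; apply: is_pdM.
    by apply: is_pd_linear; apply: (@coord_lin k (fun A => qmul A v)); exact: qmulr_linear.
  exact: smooth_is_pd (smooth_pd _ sf) UA.
rewrite (pd_coord _ sf UA) -big_split /= -(is_pd_pd D).
apply: (eq_pd oU UA); last exact (is_pd_pdable (smooth_is_pd w (smooth_pd_qmul v sf) UA)).
by move=> B UB; rewrite (pd_coord _ sf UB).
Qed.

(* The second order terms cancel by the symmetry of second derivatives. *)
Lemma pd_bracket f A u v : smooth_on U (f : gl -> R^o) -> U A ->
  pd (qmul A u) (fun B => pd (qmul B v) f B) A
  - pd (qmul A v) (fun B => pd (qmul B u) f B) A = pd (qmul A (qlie u v)) f A.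
Proof.
move=> sf UA.
pose T w w' := \sum_k coord b k (qmul A w) * pd (qmul A w') (pd b`_k f) A.
have TE w w' : T w w' =
   \sum_k \sum_l coord b k (qmul A w) * (coord b l (qmul A w') * pd b`_l (pd b`_k f) A).
  by apply: eq_bigr => k _; rewrite (pd_coord _ (smooth_pd _ sf) UA) mulr_sumr.
have TC : T v u = T u v.
  rewrite (TE v u) (TE u v) exchange_big; apply: eq_bigr => k _; apply: eq_bigr => l _.
  by rewrite mulrCA (smooth_pdC oU b`_k b`_l sf UA).
have P w w' : pd (qmul A w) (fun B => pd (qmul B w') f B) A = pd (qmul (qmul A w) w') f A + T w' w
  := pd_pd_qmul w' (qmul A w) sf UA.
have P' : pd (qmul A v) (fun B => pd (qmul B u) f B) A = pd (qmul (qmul A v) u) f A + T v u.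
  by rewrite TC; exact (P v u).
have aux (a c p q t : R) : a = p + t -> c = q + t -> a - c = p - q.
  by move=> -> ->; ring.
have L := smooth_pd_linear oU sf UA (-1) (qmul (qmul A v) u) (qmul (qmul A u) v).
rewrite scaleN1r mulN1r addrC in L.
rewrite (aux _ _ _ _ _ (P u v) P') /qlie qmulDr qmulNr !qmulA L.
by rewrite addrC.
Qed.

End QuaternionicSmooth.

(** * The groups PGL(n+1, H) and G_0 *)

Section UnitQuaternions.
Context {R : realType}.
Implicit Types q a : qmx R 1 1.

Definition qconj m n (q : qmx R m n) : qmx R m n := (qre q, - qimi q, - qimj q, - qimk q).

Definition qnorm2 q : R :=
  qre q 0 0 ^+ 2 + qimi q 0 0 ^+ 2 + qimj q 0 0 ^+ 2 + qimk q 0 0 ^+ 2.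

Lemma mulmx11 (a b : 'M[R]_1) : (a *m b) 0 0 = a 0 0 * b 0 0.
Proof. by rewrite mxE big_ord1. Qed.

Lemma qconjP q : qmul q (qconj q) = qnorm2 q *: qone 1 /\ qmul (qconj q) q = qnorm2 q *: qone 1.
Proof.
move: q => [[[a0 a1] a2] a3].
rewrite /qconj /qnorm2 /qmul /qone /qre /qimi /qimj /qimk /=.
split; congr (_, _, _, _); apply/matrixP => i j; rewrite !ord1;
by rewrite ?(addmxE, oppmxE, mulmx11) !mxE ?eqxx /= ?mulr1n; ring.
Qed.

Lemma qnorm2_ge0 q : 0 <= qnorm2 q.
Proof. by rewrite /qnorm2 !addr_ge0 ?sqr_ge0. Qed.

Lemma qnorm2_eq0 q : (qnorm2 q == 0) = (q == 0).
Proof.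
apply/eqP/eqP => [|->]; last first.
  by rewrite /qnorm2 /qre /qimi /qimj /qimk /= !mxE expr0n /= !addr0.
move: q => [[[a0 a1] a2] a3]; rewrite /qnorm2 /qre /qimi /qimj /qimk /= => H.
have [H0 H1 H2 H3] : [/\ a0 0 0 = 0, a1 0 0 = 0, a2 0 0 = 0 & a3 0 0 = 0] by split; nra.
by congr (_, _, _, _); apply/matrixP => i j; rewrite !ord1 !mxE.
Qed.

Lemma qinverse1 q : q != 0 -> qinverse q ((qnorm2 q)^-1 *: qconj q).
Proof.
rewrite -qnorm2_eq0 => q0; have [L M] := qconjP q.
by split; rewrite ?qmulZl ?qmulZr ?L ?M scalerA mulVf ?scale1r.
Qed.

Lemma qinverseP1 q q' : qinverse q q' -> q != 0.
Proof.
move=> [qq' _]; apply/eqP => q0; move: qq'; rewrite q0 qmul0l.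
move/(congr1 (fun x : qmx R 1 1 => qre x 0 0)); rewrite /qre /= !mxE eqxx.
by move/eqP; rewrite eq_sym oner_eq0.
Qed.

Lemma qnorm2Z c q : qnorm2 (c *: q) = c ^+ 2 * qnorm2 q.
Proof.
move: q => [[[a0 a1] a2] a3]; rewrite /qnorm2 /qre /qimi /qimj /qimk /= !mxE; ring.
Qed.

Lemma qnorm2M p q : qnorm2 (qmul p q) = qnorm2 p * qnorm2 q.
Proof.
move: p q => [[[a0 a1] a2] a3] [[[b0 b1] b2] b3].
rewrite /qnorm2 /qmul /qre /qimi /qimj /qimk /= ?(addmxE, oppmxE, mulmx11); ring.
Qed.

Lemma Sp1E q : Sp1 q = (qnorm2 q = 1).
Proof. by []. Qed.

Lemma Sp1_neq0 q : Sp1 q -> q != 0.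
Proof. by rewrite Sp1E -qnorm2_eq0 => ->; rewrite oner_eq0. Qed.

Lemma Sp1_1 : Sp1 (qone 1 : qmx R 1 1).
Proof. by rewrite Sp1E /qnorm2 /qre /qimi /qimj /qimk /= !mxE /= expr1n expr0n /= !addr0. Qed.

Lemma Sp1M p q : Sp1 p -> Sp1 q -> Sp1 (qmul p q).
Proof. by rewrite !Sp1E qnorm2M => -> ->; rewrite mulr1. Qed.

Lemma Sp1V p q : Sp1 p -> qinverse p q -> Sp1 q.
Proof.
rewrite !Sp1E => p1 [pq _]; have := qnorm2M p q; rewrite pq p1 mul1r => <-.
exact: Sp1_1.
Qed.

End UnitQuaternions.

Section ProjectiveGroup.
Context {R : realType} {n : nat}.
Local Notation gl := (qmx R (1 + n) (1 + n)).
Local Notation PGL := (PGL R n).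
Implicit Types (A B C : gl) (g h : PGL).

Lemma PGL_inj g h : sval g = sval h -> g = h.
Proof.
case: g h => [C Cx] [D Dx] /= CD; subst D.
by congr exist; exact: Prop_irrelevance.
Qed.

Lemma sval_pclass A : GLH A -> sval (pclass A) = real_class A.
Proof. by rewrite /pclass => GA; case: pselect. Qed.

Lemma real_classZ r A : r != 0 -> real_class (r *: A) = real_class A.
Proof.
move=> r0; apply/seteqP; split=> B [s /= s0 <-].
  by exists (s * r); rewrite /= ?mulf_neq0// scalerA.
by exists (s / r); rewrite /= ?mulf_neq0 ?invr_eq0// scalerA divfK.
Qed.

Lemma pclassZ r A : r != 0 -> GLH A -> pclass (r *: A) = pclass A.
Proof.
move=> r0 GA; apply: PGL_inj; rewrite !sval_pclass ?real_classZ //.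
exact: GLHZ.
Qed.

Lemma GLH_prep g : GLH (prep g).
Proof. by rewrite /prep; case: cid2. Qed.

Lemma pclass_prep g : pclass (prep g) = g.
Proof.
apply: PGL_inj; rewrite sval_pclass; last exact: GLH_prep.
by rewrite /prep; case: cid2.
Qed.

(** All that is known of the chosen representative; what is computed from it has to be insensitive
    to the factor r. *)
Lemma prep_pclass A : GLH A -> exists2 r, r != 0 & prep (pclass A) = r *: A.
Proof.
move=> GA; have : real_class (prep (pclass A)) = real_class A.
  by rewrite -!sval_pclass ?pclass_prep//; exact: GLH_prep.
move=> E; have : real_class (prep (pclass A)) (prep (pclass A)).
  by exists 1; rewrite /= ?oner_eq0 ?scale1r.
by rewrite E => -[r /= r0 <-]; exists r.
Qed.

Lemma pmulE A B : GLH A -> GLH B -> pmul (pclass A) (pclass B) = pclass (qmul A B).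
Proof.
move=> GA GB; rewrite /pmul.
have [r r0 ->] := prep_pclass GA; have [s s0 ->] := prep_pclass GB.
by rewrite qmulZl qmulZr scalerA pclassZ ?mulf_neq0//; exact: GLHM.
Qed.

Lemma pmulA g h k : pmul g (pmul h k) = pmul (pmul g h) k.
Proof.
rewrite -(pclass_prep g) -(pclass_prep h) -(pclass_prep k).
have [Gg Gh Gk] := And3 (GLH_prep g) (GLH_prep h) (GLH_prep k).
rewrite (pmulE Gh Gk) (pmulE Gg Gh) (pmulE Gg (GLHM Gh Gk)) (pmulE (GLHM Gg Gh) Gk).
by rewrite qmulA.
Qed.

Lemma pmul_pone g : pmul g (pone R n) = g.
Proof.
rewrite -[in LHS](pclass_prep g).
have -> : pone R n = pclass (qone (1 + n)).
  by apply: PGL_inj; rewrite sval_pclass //; exact: GLH1.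
by rewrite pmulE ?qmul1r ?pclass_prep//; [exact: GLH_prep | exact: GLH1].
Qed.

Lemma prep_invP g : qinverse (prep g) (prep_inv g).
Proof.
rewrite /prep_inv; have [B AB] := GLH_prep g.
by apply: (@xgetPex _ 0 [set B | qinverse (prep g) B]); exists B.
Qed.

Lemma AdE A B v : qinverse A B -> Ad (pclass A) v = qmul (qmul A v) B.
Proof.
move=> AB; have GA : GLH A by exists B.
rewrite /Ad; have P := prep_invP (pclass A).
have [r r0 E] := prep_pclass GA; rewrite E in P *.
rewrite (qinverse_uniq P (qinverseZ r0 AB)) !(qmulZl, qmulZr) scalerA.
by rewrite divff // scale1r.
Qed.

Lemma Ad_linear g : linear (Ad g : gl -> gl).
Proof. by move=> a u v; rewrite /Ad qmulDr qmulDl qmulZr qmulZl. Qed.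

Lemma qinverse_block (a b : qmx R 1 1) (D E : qmx R n n) :
  qinverse a b -> qinverse D E -> qinverse (qblock a 0 0 D) (qblock b 0 0 E).
Proof.
move=> [ab ba] [DE ED]; split; rewrite qmul_block !qmul0l !qmul0r !addr0 !add0r.
  by rewrite ab DE; exact: qblock1.
by rewrite ba ED; exact: qblock1.
Qed.

Lemma GLH_block (a : qmx R 1 1) (D : qmx R n n) :
  a != 0 -> GLH D -> GLH (qblock a 0 0 D).
Proof.
by move=> a0 [E DE]; eexists; apply: qinverse_block DE; exact: qinverse1.
Qed.

Lemma G0P h : G0 h -> exists a b D E,
  [/\ Sp1 a, qinverse a b, qinverse D E & h = pclass (qblock a 0 0 D)].
Proof.
move=> [a [D [a1 [E DE] ->]]]; exists a, ((qnorm2 a)^-1 *: qconj a), D, E.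
by split=> //; apply/qinverse1/Sp1_neq0.
Qed.

(** Modulo real factors the whole matrix may be divided by the norm of q, so any nonzero quaternion
    is allowed in the corner. *)
Lemma G0_block (q : qmx R 1 1) (D : qmx R n n) : q != 0 -> GLH D ->
  G0 (pclass (qblock q 0 0 D)).
Proof.
move=> q0 GD; pose c := Num.sqrt (qnorm2 q).
have N0 : 0 < qnorm2 q by rewrite lt_def qnorm2_eq0 q0 qnorm2_ge0.
have c0 : c != 0 by rewrite gt_eqF // sqrtr_gt0.
exists (c^-1 *: q), (c^-1 *: D); split.
- by rewrite Sp1E qnorm2Z exprVn sqr_sqrtr ?qnorm2_ge0// mulVf ?gt_eqF.
- by apply: GLHZ; rewrite ?invr_eq0.
have -> : qblock (c^-1 *: q) 0 0 (c^-1 *: D) = c^-1 *: qblock q 0 0 D :> gl.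
  by rewrite qblockZ !scaler0.
by rewrite pclassZ ?invr_eq0//; exact: GLH_block.
Qed.

Lemma G0_1 : G0 (pone R n).
Proof.
have -> : pone R n = pclass (qblock (qone 1) 0 0 (qone n)).
  by rewrite qblock1; apply: PGL_inj; rewrite sval_pclass //; exact: GLH1.
by apply: G0_block (GLH1 _); apply: (@Sp1_neq0 R); exact: Sp1_1.
Qed.

Lemma G0M g h : G0 g -> G0 h -> G0 (pmul g h).
Proof.
move=> /G0P[a [a' [D [D' [a1 aa' DD' ->]]]]] /G0P[b [b' [E [E' [b1 bb' EE' ->]]]]].
rewrite pmulE; try by apply: GLH_block; [exact: Sp1_neq0 | eexists; eassumption].
rewrite qmul_block !qmul0l !qmul0r !addr0 !add0r; apply: G0_block.
  by apply: Sp1_neq0; exact: Sp1M.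
by apply: GLHM; [exists D' | exists E'].
Qed.

Lemma G0V h : G0 h -> exists2 k, G0 k & pmul h k = pone R n /\ pmul k h = pone R n.
Proof.
move=> /G0P[a [a' [D [D' [a1 aa' DD' ->]]]]].
have a'1 := Sp1V a1 aa'.
have Ga : GLH (qblock a 0 0 D) by apply: GLH_block; [exact: Sp1_neq0 | exists D'].
have Ga' : GLH (qblock a' 0 0 D').
  by apply: GLH_block; [exact: Sp1_neq0 | exists D; exact: qinverse_sym].
have P1 : pone R n = pclass (qone (1 + n)).
  by apply: PGL_inj; rewrite sval_pclass //; exact: GLH1.
have [L M] := qinverse_block aa' DD'.
exists (pclass (qblock a' 0 0 D')).
  by apply: G0_block; [exact: Sp1_neq0 | exists D; exact: qinverse_sym].
by rewrite !pmulE // L M P1.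
Qed.

Lemma Mproj_mul g h : G0 h -> Mproj (pmul g h) = Mproj g.
Proof.
move=> Gh; have E : [set pmul (pmul g h) k | k in G0] = [set pmul g k | k in G0].
  apply/seteqP; split=> x [k Gk <-].
    by exists (pmul h k); [exact: G0M | rewrite pmulA].
  have [h' Gh' [hh' _]] := G0V Gh.
  exists (pmul h' k); first exact: G0M.
  by rewrite !pmulA -(pmulA g) hh' pmul_pone.
rewrite /Mproj; move: (ex_intro _ _ _) (ex_intro _ _ _); rewrite E => p q.
by congr exist; exact: Prop_irrelevance.
Qed.

Lemma Mrep_proj g : exists2 h, G0 h & Mrep (Mproj g) = pmul g h.
Proof.
rewrite /Mrep; case: cid => k /= E.
have : [set pmul k h | h in G0] k by exists (pone R n); [exact: G0_1 | rewrite pmul_pone].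
by rewrite -E => -[h Gh <-]; exists h.
Qed.

Lemma Mproj_surj (x : @M R n) : Mproj (Mrep x) = x.
Proof.
rewrite /Mproj /Mrep; case: x => x px /=; case: cid => k /= E.
move: (ex_intro _ _ _); rewrite -E => q.
by congr exist; exact: Prop_irrelevance.
Qed.

End ProjectiveGroup.

(** * The Killing form *)

Section TraceForm.
Context {R : realType}.

Lemma mulmx_deltaE m n p (X : 'M[R]_(m, n)) i (j : 'I_p) k l :
  (X *m delta_mx i j) k l = X k i * (j == l)%:R.
Proof.
rewrite mxE (bigD1 i) //= big1 ?addr0 => [|r ri].
  by rewrite mxE eqxx eq_sym.
by rewrite mxE (negPf ri) mulr0.
Qed.

Lemma mxtrace_delta2 m n (A : 'M[R]_m) (B : 'M[R]_n) i j :
  \tr (A *m delta_mx i j *m (B *m delta_mx j i)) = A i i * B j j.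
Proof.
rewrite /mxtrace (bigD1 i) //= big1 ?addr0 => [|k ki]; rewrite mxE.
  rewrite (bigD1 j) //= big1 ?addr0 => [|l lj].
    by rewrite !mulmx_deltaE !eqxx !mulr1.
  by rewrite mulmx_deltaE eq_sym (negPf lj) mulr0 mul0r.
by apply: big1 => l _; rewrite [X in _ * X]mulmx_deltaE eq_sym (negPf ki) !mulr0.
Qed.

Lemma mxtrace_delta m n (A : 'M[R]_(m, n)) i j :
  \tr (delta_mx j i *m A) = A i j.
Proof.
rewrite mxtrace_mulC /mxtrace (bigD1 i) //= big1 ?addr0 => [|k ki].
  by rewrite mulmx_deltaE eqxx mulr1.
by rewrite mulmx_deltaE eq_sym (negPf ki) mulr0.
Qed.

(** The conjugate transpose of a basis element is its dual for the real trace pairing. *)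
Lemma retr_dual m n t (v : qmx R m n) i j :
  retr (qmul (qconj (qiota t (delta_mx j i))) v) = qcomp t v i j.
Proof.
move: v => [[[v0 v1] v2] v3].
case: t => -[|[|[|[|//]]]] ti; rewrite /retr /qconj /qiota /qmul /qcomp /qre /qimi /qimj /qimk /=;
by rewrite ?oppr0 ?mul0mx ?mulNmx ?opprK ?(subr0, add0r, sub0r, opprK) mxtrace_delta.
Qed.

(** The underlying identity for a quaternion d is d - i d i - j d j - k d k = 4 Re d. *)
Lemma retr_sandwich m (C D : qmx R m m) i j :
  \sum_t retr (qmul (qmul C (qiota t (delta_mx i j))) (qmul D (qconj (qiota t (delta_mx j i)))))
  = 4%:R * qre C i i * qre D j j.
Proof.
move: C D => [[[c0 c1] c2] c3] [[[d0 d1] d2] d3].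
rewrite sum4 /retr /qconj /qiota !inordK //= /qmul /qre /qimi /qimj /qimk /=.
rewrite ?(oppr0, mulmx0, subr0, add0r, sub0r, addr0) ?(mulNmx, mulmxN, opprK).
rewrite ?(raddfB, raddfD, raddfN) /= !mxtrace_delta2; ring.
Qed.

Lemma retr1 m : retr (qone m : qmx R m m) = m%:R.
Proof. exact: mxtrace1. Qed.

(** The left side is the trace of the real operator X |-> C X D. With [ad A ad B] written as A B X -
    A X B - B X A + X B A, the outer two terms each contribute 4 (n+1) Re tr(AB): hence the factor 8
    (n+1). *)
Lemma trace_sandwich m (C D : qmx R m m) :
  \sum_t \sum_i \sum_j qcomp t (qmul (qmul C (qiota t (delta_mx i j))) D) i j
  = 4%:R * retr C * retr D.
Proof.
rewrite exchange_big /=.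
under eq_bigr do rewrite exchange_big /=.
rewrite [in RHS]/retr /mxtrace -mulrA big_distrlr /= mulr_sumr.
apply: eq_bigr => i _; rewrite mulr_sumr; apply: eq_bigr => j _.
rewrite mulrA -retr_sandwich; apply: eq_bigr => t _.
by rewrite -retr_dual retr_mulC -qmulA.
Qed.

End TraceForm.

(** * Block decomposition of sl(n+1, H) and value of the Killing form *)

Section LinearAlgebra.
Context {R : realType} {n : nat}.
Local Notation gl := (qmx R (1 + n) (1 + n)).
Local Notation tangent := (tangent R n).
Implicit Types (A B : gl) (x : qmx R n 1) (z : qmx R 1 n).

Lemma mem_sl A : (A \in sl R n) = (retr A == 0).
Proof.
rewrite /sl memv_ker linfunE // => a u v.
exact: linearP.
Qed.

Lemma neg_embedE x : neg_embed x = qblock 0 0 x 0 :> gl.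
Proof.
rewrite /neg_embed linfunE // => a u v.
by rewrite qblockZ qblockD !scaler0 !addr0.
Qed.

Lemma pos_embedE z : pos_embed z = qblock 0 z 0 0 :> gl.
Proof.
rewrite /pos_embed linfunE // => a u v.
by rewrite qblockZ qblockD !scaler0 !addr0.
Qed.

Lemma diag_embedE ad : diag_embed ad = qblock ad.1 0 0 ad.2 :> gl.
Proof.
rewrite /diag_embed linfunE // => a u v.
by rewrite qblockZ qblockD !scaler0 !addr0.
Qed.

Lemma g_negP A : reflect (exists x, A = qblock 0 0 x 0) (A \in g_neg).
Proof.
apply: (iffP memv_imgP) => [[x _ ->]|[x ->]]; exists x; rewrite ?neg_embedE ?memvf //.
Qed.

Lemma p_posP A : reflect (exists z, A = qblock 0 z 0 0) (A \in p_pos).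
Proof.
apply: (iffP memv_imgP) => [[x _ ->]|[x ->]]; exists x; rewrite ?pos_embedE ?memvf //.
Qed.

Lemma lker_neg : lker (@neg_embed R n) = 0%VS.
Proof.
by apply/eqP/lker0P => x y; rewrite !neg_embedE => /qblock_inj[].
Qed.

Lemma lker_pos : lker (@pos_embed R n) = 0%VS.
Proof.
by apply/eqP/lker0P => x y; rewrite !pos_embedE => /qblock_inj[].
Qed.

Lemma dim_qmx m p : \dim {: qmx R m p} = (4 * (m * p))%N.
Proof. by rewrite dimvf (_ : dim _ = (m * p + m * p + m * p + m * p)%N) //; lia. Qed.

Lemma dim_g_neg : \dim (@g_neg R n) = (4 * n)%N.
Proof. by rewrite limg_dim_eq ?lker_neg ?capv0 // dim_qmx muln1. Qed.

Lemma dim_p_pos : \dim (@p_pos R n) = (4 * n)%N.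
Proof. by rewrite limg_dim_eq ?lker_pos ?capv0 // dim_qmx mul1n. Qed.

Lemma cap_neg_pos : (@g_neg R n :&: p_pos)%VS = 0%VS.
Proof.
apply/eqP; rewrite -subv0; apply/subvP => A; rewrite memv_cap memv0.
by case/andP=> /g_negP[x ->] /p_posP[z /qblock_inj[_ _ -> _]]; rewrite qblock0.
Qed.

Lemma tangentP A : reflect (exists x z, A = qblock 0 z x 0) (A \in @tangent_space R n).
Proof.
apply: (iffP memv_addP) => [[_ /g_negP[x ->] [_ /p_posP[z ->] ->]]|[x [z ->]]].
  by exists x, z; rewrite qblockD !addr0 !add0r.
exists (qblock 0 0 x 0); first by apply/g_negP; exists x.
exists (qblock 0 z 0 0); first by apply/p_posP; exists z.
by rewrite qblockD !addr0 !add0r.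
Qed.

Lemma dim_tangent_space : \dim (@tangent_space R n) = (8 * n)%N.
Proof.
rewrite /tangent_space dimv_disjoint_sum ?cap_neg_pos // dim_g_neg dim_p_pos; lia.
Qed.

Lemma dim_tangent : \dim {: tangent} = (8 * n)%N.
Proof. by rewrite dimvf /dim /= dim_tangent_space. Qed.

(** Off-diagonal blocks do not contribute to the trace, so sl is the direct sum of [g_zero] and
    [tangent_space]. *)
Lemma dim_sl_g_zero : \dim (sl R n) = (\dim (g_zero R n) + 8 * n)%N.
Proof.
have -> : sl R n = (g_zero R n + tangent_space)%VS.
  apply/eqP; rewrite eqEsubv; apply/andP; split; apply/subvP => A.
    have [a [b [c [d ->]]]] := qblockP A; rewrite mem_sl retr_block => /eqP ad.
    apply/memv_addP; exists (qblock a 0 0 d).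
      rewrite memv_cap mem_sl retr_block ad eqxx andbT.
      by apply/memv_imgP; exists (a, d); rewrite ?memvf ?diag_embedE.
    exists (qblock 0 b c 0); first by apply/tangentP; exists c, b.
    by rewrite qblockD !addr0 !add0r.
  case/memv_addP => B; rewrite memv_cap => /andP[_ Bsl] [C /tangentP[x [z ->]] ->].
  apply: memvD => //; rewrite mem_sl retr_block.
  by rewrite /retr /qre /= !mxtrace0 addr0.
rewrite dimv_disjoint_sum ?dim_tangent_space //.
apply/eqP; rewrite -subv0; apply/subvP => A; rewrite !memv_cap memv0.
case/andP=> /andP[/memv_imgP[[a d] _ ->] _] /tangentP[x [z]].
by rewrite diag_embedE => /qblock_inj[/= -> _ _ ->]; rewrite qblock0.
Qed.

Lemma qlie_linear A : linear (qlie A).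
Proof.
move=> a u v; rewrite /qlie qmulDr qmulDl qmulZr qmulZl scalerBr opprD.
by rewrite addrACA.
Qed.

(* The trace of [ad A ad B] on gl(n+1, H) is that on sl(n+1, H), as the
   operator kills the identity and takes its values in sl(n+1, H); on gl it is
   computed in the basis of the [qiota t (delta_mx i j)]. *)
Lemma killingE A B :
  killing A B = 8%:R * n.+1%:R * retr (qmul A B) - 8%:R * retr A * retr B.
Proof.
pose f X := qlie A (qlie B X).
have fl : linear f by move=> a u v; rewrite /f !qlie_linear.
have FE X : linfun f X = f X by rewrite linfunE.
pose b := vbasis (sl R n).
have fsl X : f X \in sl R n.
  by rewrite mem_sl /f /qlie retrD retrN retr_mulC subrr.
have f1 : f (qone _) = 0 by rewrite /f /qlie qmul1l qmul1r subrr qmul0l qmul0r subrr.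
(* The projection of gl onto sl along the real multiples of the identity. *)
pose p X : gl := (- (retr X / n.+1%:R)) *: (qone (1 + n) : gl) + X.
have psl X : p X \in sl R n.
  by rewrite mem_sl /p retrD retrZ retr1 mulNr divfK ?addNr // pnatr_eq0.
have fp X : f (p X) = f X.
  by rewrite /p fl f1 scaler0 add0r.
have pid X : X \in sl R n -> p X = X.
  by rewrite mem_sl => /eqP rX; rewrite /p rX mul0r oppr0 scale0r add0r.
pose I := ('I_4 * 'I_(1 + n) * 'I_(1 + n))%type.
pose e (s : I) : gl := qiota s.1.1 (delta_mx s.1.2 s.2).
pose c (s : I) (X : gl) : R := qcomp s.1.1 X s.1.2 s.2.
have qsum X : X = \sum_s c s X *: e s.
  by rewrite [LHS]qmx_sum pair_bigA /= pair_bigA.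
have pl : linear p.
  move=> a u v; rewrite /p retrD retrZ mulrDl scalerDr opprD scalerDl -mulrA -mulrN scalerA.
  by rewrite addrACA.
have PE X : linfun p X = p X by rewrite linfunE.
have cl s : linear (c s : gl -> R^o).
  by move=> a u v; rewrite /c qcomp_linear !mxE.
have CE s X : linfun (c s : gl -> R^o) X = c s X by rewrite linfunE //; exact: cl.
have -> : killing A B = \sum_s c s (f (e s)).
  (* The double sum is the trace of the composite of p with f restricted to sl. Summed over s first
     it is the trace on sl, as p fixes the values of f; summed over i first it is the trace on gl,
     as f p = f. *)
  transitivity (\sum_(i < \dim (sl R n)) \sum_s c s (f b`_i) * coord b i (p (e s))).
    apply: eq_bigr => i _; rewrite -[qlie A _]/(f _) (tnth_nth 0) -/b.
    rewrite -[in LHS](pid (f b`_i)) // {1}(qsum (f b`_i)) -PE !linear_sum.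
    by apply: eq_bigr => s _; rewrite !linearZ /= PE.
  rewrite exchange_big; apply: eq_bigr => s _ /=.
  rewrite -[in RHS]fp {2}(coord_vbasis (psl (e s))) -FE -CE !linear_sum.
  by apply: eq_bigr => i _; rewrite !linearZ /= CE FE mulrC.
transitivity (\sum_t \sum_i \sum_j qcomp t (f (qiota t (delta_mx i j))) i j).
  by rewrite pair_bigA /= pair_bigA.
(* Identity factors are inserted so that all four terms have the form C X D of [trace_sandwich]. *)
transitivity (\sum_t \sum_i \sum_j
  (qcomp t (qmul (qmul (qmul A B) (qiota t (delta_mx i j))) (qone _)) i j
   - qcomp t (qmul (qmul A (qiota t (delta_mx i j))) B) i j
   - (qcomp t (qmul (qmul B (qiota t (delta_mx i j))) A) i j
   - qcomp t (qmul (qmul (qone _) (qiota t (delta_mx i j))) (qmul B A)) i j)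
   )).
  apply: eq_bigr => t _; apply: eq_bigr => i _; apply: eq_bigr => j _.
  rewrite /f /qlie qmulDr qmulDl qmulNr qmulNl qmul1l qmul1r !qmulA.
  have qB (u v : gl) : qcomp t (u - v) i j = qcomp t u i j - qcomp t v i j.
    by rewrite [u - v]addrC -[- v]scaleN1r qcomp_linear scaleN1r addmxE oppmxE addrC.
  by rewrite !qB.
have S3 (a d : 'I_4 -> 'I_(1 + n) -> 'I_(1 + n) -> R) :
    \sum_t \sum_i \sum_j (a t i j - d t i j) =
    \sum_t \sum_i \sum_j a t i j - \sum_t \sum_i \sum_j d t i j.
  rewrite -sumrB; apply: eq_bigr => t _; rewrite -sumrB; apply: eq_bigr => i _.
  by rewrite -sumrB.
rewrite !S3 !trace_sandwich !retr1 (retr_mulC B A); ring.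
Qed.

End LinearAlgebra.

(** * The isotropy representation *)

Section Isotropy.
Context {R : realType} {n : nat}.
Local Notation gl := (qmx R (1 + n) (1 + n)).
Local Notation tangent := (tangent R n).
Implicit Types (A B : gl) (x : qmx R n 1) (z : qmx R 1 n) (u v : tangent) (q : qmx R 1 1).

Definition tvec x z : tangent := vsproj (@tangent_space R n) (qblock 0 z x 0).

Lemma vsval_tvec x z : vsval (tvec x z) = qblock 0 z x 0.
Proof. by rewrite /tvec vsprojK //; apply/tangentP; exists x, z. Qed.

Lemma tvecP u : exists x z, u = tvec x z.
Proof.
have /tangentP[x [z E]] := subvsP u.
by exists x, z; apply/val_inj; rewrite /= vsval_tvec.
Qed.

Lemma tvecD x z x' z' : tvec x z + tvec x' z' = tvec (x + x') (z + z').
Proof. by apply/val_inj; rewrite /= !vsval_tvec qblockD !addr0. Qed.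

Lemma tvecZ c x z : c *: tvec x z = tvec (c *: x) (c *: z).
Proof. by apply/val_inj; rewrite /= !vsval_tvec qblockZ !scaler0. Qed.

Lemma tvecN x z : - tvec x z = tvec (- x) (- z).
Proof. by rewrite -scaleN1r tvecZ !scaleN1r. Qed.

Lemma neg_pos_part x z :
  neg_part (tvec x z) = qblock 0 0 x 0 /\ pos_part (tvec x z) = qblock 0 z 0 0.
Proof.
rewrite /neg_part /pos_part vsval_tvec.
set A := qblock 0 z x 0.
have E : daddv_pi g_neg p_pos A + daddv_pi p_pos g_neg A = A.
  apply: daddv_pi_add; first exact: cap_neg_pos.
  by apply/tangentP; exists x, z.
have /g_negP[y Ey] := memv_pi g_neg p_pos A.
have /p_posP[w Ew] := memv_pi p_pos g_neg A.
move: E; rewrite Ey Ew qblockD /A !addr0 !add0r => /qblock_inj[_ -> -> _].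
by [].
Qed.

Lemma Ad_block (a b : qmx R 1 1) (D E : qmx R n n) x z : qinverse a b -> qinverse D E ->
  Ad (pclass (qblock a 0 0 D)) (qblock 0 z x 0) =
  qblock 0 (qmul (qmul a z) E) (qmul (qmul D x) b) 0.
Proof.
move=> ab DE; rewrite (AdE _ (qinverse_block ab DE)) !qmul_block.
by rewrite !(qmul0l, qmul0r, addr0, add0r).
Qed.

Lemma isotropy_linear (h : PGL R n) :
  linear (fun u : tangent => vsproj (@tangent_space R n) (Ad h (vsval u))).
Proof. by move=> a u v; rewrite linearP Ad_linear linearP. Qed.

Lemma isotropyE (h : PGL R n) u : isotropy h u = vsproj (@tangent_space R n) (Ad h (vsval u)).
Proof. by rewrite /isotropy linfunE //; exact: isotropy_linear. Qed.

Lemma isotropy_tvec (a b : qmx R 1 1) (D E : qmx R n n) x z :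
  qinverse a b -> qinverse D E ->
  isotropy (pclass (qblock a 0 0 D)) (tvec x z) =
  tvec (qmul (qmul D x) b) (qmul (qmul a z) E).
Proof. by move=> ab DE; rewrite isotropyE vsval_tvec (Ad_block _ _ ab DE). Qed.

Lemma vsval_isotropy (h : PGL R n) u : G0 h -> vsval (isotropy h u) = Ad h (vsval u).
Proof.
move=> /G0P[a [b [D [E [_ ab DE ->]]]]]; have [x [z ->]] := tvecP u.
by rewrite (isotropy_tvec _ _ ab DE) !vsval_tvec (Ad_block _ _ ab DE).
Qed.

Lemma neg_is_EH_holds : neg_is_EH R n.
Proof.
split; first exact: lker_neg.
move=> a b D x _ ab [E DE].
by rewrite !neg_embedE (Ad_block _ _ ab DE) qmul0r qmul0l.
Qed.

Lemma killing_neg_pos x z :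
  killing (qblock 0 0 x 0 : gl) (qblock 0 z 0 0) = 8%:R * n.+1%:R * retr (qmul z x).
Proof.
rewrite killingE qmul_block !(qmul0l, qmul0r, addr0, add0r) !retr_block.
have r0 m : retr (0 : qmx R m m) = 0 by rewrite /retr mxtrace0.
by rewrite !r0 !addr0 !add0r !mulr0 subr0 retr_mulC.
Qed.

Lemma qmx_eq0 m p (v : qmx R m p) :
  (forall t i j, qcomp t v i j = 0) -> v = 0.
Proof.
move=> v0; rewrite [v]qmx_sum; apply: big1 => t _; apply: big1 => i _.
by apply: big1 => j _; rewrite v0 scale0r.
Qed.

(** By [retr_dual], each real component of v is its pairing with a suitable w. *)
Lemma retr_nondeg m p (v : qmx R m p) :
  (forall w : qmx R p m, retr (qmul w v) = 0) -> v = 0.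
Proof.
move=> H; apply: qmx_eq0 => t i j.
by rewrite -retr_dual H.
Qed.

Lemma killing_factor_neq0 : 8%:R * n.+1%:R != 0 :> R.
Proof. by rewrite mulf_neq0 // pnatr_eq0. Qed.

Lemma killing_duality_holds : killing_duality R n.
Proof.
split.
- move=> h _ _ /G0P[a [b [D [E [_ ab DE ->]]]]] /g_negP[x ->] /p_posP[z ->].
  rewrite !(Ad_block _ _ ab DE) !(qmul0l, qmul0r); split.
  + by apply/g_negP; eexists.
  + by apply/p_posP; eexists.
  rewrite !killing_neg_pos retr_mulC; congr (_ * _).
  rewrite qmulA -[qmul (qmul (qmul D x) b) _]qmulA [qmul b _]qmulA (proj2 ab) qmul1l.
  by rewrite -!qmulA retr_mulC -!qmulA (proj2 DE) qmul1r retr_mulC.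
- move=> _ /g_negP[x ->] H; rewrite (_ : x = 0) ?qblock0 //.
  apply: retr_nondeg => z; apply: (mulfI killing_factor_neq0); rewrite mulr0 -killing_neg_pos.
  by apply: H; apply/p_posP; exists z.
move=> _ /p_posP[z ->] H; rewrite (_ : z = 0) ?qblock0 //.
apply: retr_nondeg => x; apply: (mulfI killing_factor_neq0).
rewrite mulr0 retr_mulC -killing_neg_pos.
by apply: H; apply/g_negP; exists x.
Qed.

Lemma omegaE x z x' z' : omega_W R n (tvec x z) (tvec x' z') =
  8%:R * n.+1%:R * (retr (qmul z' x) - retr (qmul z x')).
Proof.
rewrite /omega_W; have [-> ->] := neg_pos_part x z; have [-> ->] := neg_pos_part x' z'.
by rewrite !killing_neg_pos mulrBr.
Qed.

Lemma omega_linearl v : linear (fun u => omega_W R n u v : R^o).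
Proof.
move=> c u u'; have [x [z ->]] := tvecP u; have [x' [z' ->]] := tvecP u'.
have [y [w ->]] := tvecP v; rewrite tvecZ tvecD !omegaE.
rewrite qmulDl qmulDr qmulZl qmulZr !retrD !retrZ.
have aux (k d a b a' b' : R) :
  k * (d * a + a' - (d * b + b')) = d * (k * (a - b)) + k * (a' - b') by ring.
exact: aux.
Qed.

Lemma omega_anti u v : omega_W R n u v = - omega_W R n v u.
Proof.
have [x [z ->]] := tvecP u; have [x' [z' ->]] := tvecP v; rewrite !omegaE; ring.
Qed.

Lemma omega_alt u : omega_W R n u u = 0.
Proof. by have [x [z ->]] := tvecP u; rewrite omegaE subrr mulr0. Qed.

Lemma omega_isotropy h u v : G0 h ->
  omega_W R n (isotropy h u) (isotropy h v) = omega_W R n u v.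
Proof.
move=> /G0P[a [b [D [E [_ ab DE ->]]]]].
have [x [z ->]] := tvecP u; have [x' [z' ->]] := tvecP v.
rewrite !(isotropy_tvec _ _ ab DE) !omegaE.
have S (y : qmx R n 1) (w : qmx R 1 n) :
   retr (qmul (qmul (qmul a w) E) (qmul (qmul D y) b)) = retr (qmul w y).
  rewrite -!qmulA [qmul E (qmul D _)]qmulA (proj2 DE) qmul1l retr_mulC -!qmulA.
  by rewrite (proj2 ab) qmul1r.
by rewrite (S x z') (S x' z).
Qed.

Lemma omega_nondeg u : (forall v, omega_W R n u v = 0) -> u = 0.
Proof.
have [x [z ->]] := tvecP u => H.
have -> : x = 0.
  apply: retr_nondeg => w; have := H (tvec 0 w).
  rewrite omegaE qmul0r {2}/retr mxtrace0 subr0 => /eqP.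
  by rewrite mulf_eq0 (negPf killing_factor_neq0) => /eqP.
have -> : z = 0.
  apply: retr_nondeg => w; have := H (tvec w 0).
  rewrite omegaE qmul0l {1}/retr mxtrace0 sub0r => /eqP.
  by rewrite mulf_eq0 (negPf killing_factor_neq0) oppr_eq0 retr_mulC => /eqP.
by apply/val_inj; rewrite /= vsval_tvec qblock0.
Qed.

Definition Jq q : 'End(tangent) := ad_tangent (qblock q 0 0 0).

Lemma ad_tangent_linear A :
  linear (fun u : tangent => vsproj (@tangent_space R n) (qlie A (vsval u))).
Proof. by move=> a u v; rewrite linearP qlie_linear linearP. Qed.

Lemma ad_tangentE A u :
  ad_tangent A u = vsproj (@tangent_space R n) (qlie A (vsval u)).
Proof. by rewrite /ad_tangent linfunE //; exact: ad_tangent_linear. Qed.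

Lemma JqE q x z : Jq q (tvec x z) = tvec (- qmul x q) (qmul q z).
Proof.
rewrite /Jq ad_tangentE vsval_tvec.
rewrite /qlie !qmul_block qblockN qblockD !(qmul0l, qmul0r, oppr0, addr0, add0r).
by [].
Qed.

Lemma end_tvecP (f g : 'End(tangent)) :
  (forall x z, f (tvec x z) = g (tvec x z)) -> f = g.
Proof. by move=> fg; apply/lfunP => u; have [x [z ->]] := tvecP u. Qed.

Lemma Jq_linear : linear (Jq : qmx R 1 1 -> 'End(tangent)).
Proof.
move=> a p q; apply: end_tvecP => x z; rewrite add_lfunE scale_lfunE !JqE tvecZ tvecD.
by rewrite qmulDl qmulZl qmulDr qmulZr opprD -scalerN.
Qed.

Lemma Jq_comp p q x z : (Jq p \o Jq q)%VF (tvec x z) =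
  tvec (qmul x (qmul q p)) (qmul (qmul p q) z).
Proof. by rewrite comp_lfunE !JqE qmulNl opprK !qmulA. Qed.

(** The composite multiplies x on the right by q p and z on the left by p q, while [Jq r] acts on x
    with an additional sign. The two parts agree with [Jq r] exactly because p and q anticommute. *)
Lemma Jq_anti p q r : qmul p q = r -> qmul q p = - r -> (Jq p \o Jq q)%VF = Jq r.
Proof. by move=> pq qp; apply: end_tvecP => x z; rewrite Jq_comp pq qp JqE qmulNr. Qed.

Lemma Jq_sq p : qmul p p = - qone 1 -> (Jq p \o Jq p = - \1)%VF.
Proof.
move=> pp; apply: end_tvecP => x z.
by rewrite Jq_comp pp qmulNr qmul1r qmulNl qmul1l opp_lfunE id_lfunE tvecN.
Qed.

Lemma retr11 q : retr q = qre q 0 0.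
Proof. exact: trace_mx11. Qed.

Lemma Q_WP J : reflect (exists2 q, retr q = 0 & J = Jq q) (J \in Q_W R n).
Proof.
have lad : linear (ad_tangent : gl -> 'End(tangent)).
  move=> a A B; apply/lfunP => u; rewrite add_lfunE scale_lfunE.
  rewrite !ad_tangentE -linearP; congr (vsproj _ _).
  by rewrite /qlie qmulDl qmulDr qmulZl qmulZr opprD scalerBr addrACA.
have lsp : linear (fun v : 'rV[R]_3 =>
    qblock (0, (v 0 (inord 0))%:M, (v 0 (inord 1))%:M, (v 0 (inord 2))%:M) 0 0 0 : gl).
  move=> a u v; rewrite qblockZ qblockD !scaler0 !addr0; congr qblock.
  congr (_, _, _, _); rewrite /= ?scaler0 ?addr0 //;
  by rewrite !mxE raddfD /= scale_scalar_mx.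
apply: (iffP memv_imgP) => [[_ /memv_imgP[v _ ->] ->]|[q q0 ->]].
  rewrite linfunE // /sp1_embed linfunE //.
  by eexists; last reflexivity; rewrite retr11 /qre /= mxE.
exists (qblock q 0 0 0); last by rewrite linfunE.
apply/memv_imgP; exists (\row_(i < 3) nth 0 [:: qimi q 0 0; qimj q 0 0; qimk q 0 0] i).
  exact: memvf.
rewrite /sp1_embed linfunE // !mxE !inordK //=; congr qblock.
move: q0; rewrite retr11; move: q => [[[a0 a1] a2] a3]; rewrite /qre /qimi /qimj /qimk /= => a00.
by congr (_, _, _, _); apply/matrixP => i j; rewrite !ord1 ?a00 !mxE.
Qed.

End Isotropy.

(** * Imaginary triples and the quaternionic structure they span *)

Section QuaternionicStructure.
Context {R : realType} {n : nat}.
Local Notation gl := (qmx R (1 + n) (1 + n)).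
Local Notation tangent := (tangent R n).
Implicit Types (A B : gl) (x : qmx R n 1) (z : qmx R 1 n) (u v : tangent) (p q : qmx R 1 1).
Context (n_gt0 : (0 < n)%N).

Lemma Jq_eq0 q : Jq q = 0 :> 'End(tangent) -> q = 0.
Proof.
move=> J0; pose i := Ordinal n_gt0.
(* A unit column x and its transpose y satisfy y x = 1, so x q = 0 gives q = y x q = 0. *)
pose x : qmx R n 1 := qiota (inord 0) (delta_mx i 0).
pose y : qmx R 1 n := qiota (inord 0) (delta_mx 0 i).
have yx : qmul y x = qone 1.
  rewrite /y /x /qiota inordK //= /qmul /qone /qre /qimi /qimj /qimk /=.
  rewrite !(mulmx0, mul0mx, subr0, addr0) mul_delta_mx.
  by congr (_, _, _, _); apply/matrixP => k l; rewrite !ord1 !mxE.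
have := congr1 (fun f : 'End(tangent) => f (tvec x 0)) J0.
rewrite JqE qmul0r zero_lfunE => /(congr1 vsval); rewrite vsval_tvec /=.
rewrite -qblock0 => /qblock_inj[_ _ /eqP + _]; rewrite oppr_eq0 => /eqP xq.
by rewrite -[q]qmul1l -yx -qmulA xq qmul0r.
Qed.

Lemma Jq0 : Jq 0 = 0 :> 'End(tangent).
Proof.
apply: end_tvecP => x z; rewrite JqE zero_lfunE qmul0r qmul0l oppr0.
by apply/val_inj; rewrite /= vsval_tvec qblock0.
Qed.

Lemma JqN q : Jq (- q) = - Jq q :> 'End(tangent).
Proof.
by apply: end_tvecP => x z; rewrite opp_lfunE !JqE tvecN qmulNr qmulNl.
Qed.

Definition qunit (t : nat) : qmx R 1 1 := qiota (inord t) 1%:M.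

Record imaginary_triple p1 p2 p3 : Prop := ImaginaryTriple {
  it_re : [/\ retr p1 = 0, retr p2 = 0 & retr p3 = 0];
  it_sq : [/\ qmul p1 p1 = - qone 1, qmul p2 p2 = - qone 1 & qmul p3 p3 = - qone 1];
  it_12 : qmul p1 p2 = p3;
  it_21 : qmul p2 p1 = - p3 }.

Lemma qunit_triple : imaginary_triple (qunit 1) (qunit 2) (qunit 3).
Proof.
have M (a b : 'M[R]_1) : a *m b = (a 0 0 * b 0 0)%:M.
  by apply/matrixP => i j; rewrite !ord1 mulmx11 mxE eqxx.
split; rewrite ?retr11 /qunit /qiota !inordK //= /qmul /qone /qre /qimi /qimj /qimk /=.
- by rewrite mxE.
- by split; congr (_, _, _, _);
    rewrite !(mulmx0, mul0mx, mulmx1) ?(subr0, sub0r, addr0, add0r, oppr0).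
- by congr (_, _, _, _);
    rewrite !(mulmx0, mul0mx, mulmx1) ?(subr0, sub0r, addr0, add0r, oppr0).
- by congr (_, _, _, _);
    rewrite !(mulmx0, mul0mx, mulmx1) ?(subr0, sub0r, addr0, add0r, oppr0).
Qed.

Lemma conj_triple p1 p2 p3 q q' : qinverse q q' -> imaginary_triple p1 p2 p3 ->
  imaginary_triple (qmul (qmul q' p1) q) (qmul (qmul q' p2) q) (qmul (qmul q' p3) q).
Proof.
move=> [qq' q'q] [[r1 r2 r3] [s1 s2 s3] p12 p21].
have cr p : retr (qmul (qmul q' p) q) = retr p by rewrite retr_mulC qmulA qq' qmul1l.
have cm a b : qmul (qmul (qmul q' a) q) (qmul (qmul q' b) q) = qmul (qmul q' (qmul a b)) q.
  by rewrite !qmulA -[qmul (qmul (qmul q' a) q) q']qmulA qq' qmul1r.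
split; rewrite ?(cr p1) ?(cr p2) ?(cr p3) //.
- by split; rewrite cm ?s1 ?s2 ?s3 qmulNr qmulNl qmul1r q'q.
- by rewrite cm p12.
- by rewrite cm p21 qmulNr qmulNl.
Qed.

Lemma dim_Q_W_le : (\dim (Q_W R n) <= 3)%N.
Proof.
have L (aT rT : vectType R) (f : 'Hom(aT, rT)) (U : {vspace aT}) : (\dim (f @: U) <= \dim U)%N.
  by rewrite -(limg_ker_dim f U) leq_addl.
apply: leq_trans (L _ _ _ _) _; apply: leq_trans (L _ _ _ _) _.
by rewrite dimvf /dim /=.
Qed.

(** The real parts of the products of the p's form minus the identity matrix, so the three
    endomorphisms are independent; they span because [Q_W] has dimension at most 3. *)
Lemma triple_spans p1 p2 p3 : imaginary_triple p1 p2 p3 ->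
  \dim (Q_W R n) = 3 /\ quaternionic_triple (Q_W R n) (Jq p1) (Jq p2) (Jq p3).
Proof.
move=> [[r1 r2 r3] [s1 s2 s3] p12 p21].
pose J := [:: Jq p1; Jq p2; Jq p3] : seq 'End(tangent).
have r12 : retr (qmul p1 p2) = 0 by rewrite p12.
have p23 : qmul p2 p3 = p1 by rewrite -p12 qmulA p21 qmulNl -p12 -qmulA s2 qmulNr qmul1r opprK.
have p13 : qmul p1 p3 = - p2 by rewrite -p12 qmulA s1 qmulNl qmul1l.
have retr1N : retr (- qone 1 : qmx R 1 1) = -1 by rewrite retrN retr1.
have fJ : free J.
  apply/freeP => k; rewrite !big_ord_recl big_ord0 addr0 /=.
  have -> : k ord0 *: Jq p1 + (k (lift ord0 ord0) *: Jq p2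
      + k (lift ord0 (lift ord0 ord0)) *: Jq p3) =
    Jq (k ord0 *: p1 + (k (lift ord0 ord0) *: p2
      + k (lift ord0 (lift ord0 ord0)) *: p3)) :> 'End(tangent).
    rewrite Jq_linear; congr (_ + _); rewrite Jq_linear; congr (_ + _).
    by have := @Jq_linear R n (k (lift ord0 (lift ord0 ord0))) p3 0; rewrite !addr0 Jq0 addr0 => ->.
  set a := k ord0; set b := k (lift ord0 ord0); set c := k (lift ord0 (lift ord0 ord0)).
  move=> /Jq_eq0 E.
  (* Pairing the relation with each of p1, p2, p3 isolates one coefficient. *)
  have T w : a * retr (qmul p1 w) + (b * retr (qmul p2 w) + c * retr (qmul p3 w)) = 0.
    rewrite -!retrZ -!retrD -!qmulZl -!qmulDl E qmul0l /retr mxtrace0.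
    by [].
  have t11 : retr (qmul p1 p1) = -1 by rewrite s1.
  have t22 : retr (qmul p2 p2) = -1 by rewrite s2.
  have t33 : retr (qmul p3 p3) = -1 by rewrite s3.
  have t12 : retr (qmul p1 p2) = 0 by rewrite p12.
  have t21 : retr (qmul p2 p1) = 0 by rewrite retr_mulC.
  have t23 : retr (qmul p2 p3) = 0 by rewrite p23.
  have t32 : retr (qmul p3 p2) = 0 by rewrite retr_mulC.
  have t13 : retr (qmul p1 p3) = 0 by rewrite p13 retrN r2 oppr0.
  have t31 : retr (qmul p3 p1) = 0 by rewrite retr_mulC.
  have a0 : a = 0 by have := T p1; rewrite t11 t21 t31; lra.
  have b0 : b = 0 by have := T p2; rewrite t12 t22 t32; lra.
  have c0 : c = 0 by have := T p3; rewrite t13 t23 t33; lra.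
  move=> i; case: i => -[|[|[|//]]] Hi.
  - by rewrite -a0; congr k; apply/val_inj.
  - by rewrite -b0; congr k; apply/val_inj.
  - by rewrite -c0; congr k; apply/val_inj.
have sJ : (<<J>> <= Q_W R n)%VS.
  apply/span_subvP => f; rewrite !inE => /or3P[] /eqP ->; apply/Q_WP.
  - by exists p1.
  - by exists p2.
  - by exists p3.
have dJ : \dim <<J>> = 3%N by rewrite (eqP fJ).
have QE : Q_W R n = <<J>>%VS.
  by apply/esym/eqP; rewrite eqEdim sJ dJ dim_Q_W_le.
split; first by rewrite QE dJ.
split; [exact: Jq_sq | exact: Jq_sq | exact: Jq_sq | split | exact: QE].
  by apply: Jq_anti.
by rewrite (@Jq_anti _ _ p2 p1 (- p3)) ?opprK ?JqN.
Qed.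

(** Every J in [Q_W] is skew for omega, by the cyclicity of the real trace. With J^2 = -1 this gives
    omega(J u, J v) = - omega(u, J^2 v) = omega(u, v). *)
Lemma omega_hermitian J1 J2 J3 : quaternionic_triple (Q_W R n) J1 J2 J3 ->
  forall u v, [/\ omega_W R n (J1 u) (J1 v) = omega_W R n u v,
    omega_W R n (J2 u) (J2 v) = omega_W R n u v
  & omega_W R n (J3 u) (J3 v) = omega_W R n u v].
Proof.
move=> [s1 s2 s3 _ Q] u v.
have S J : J \in Q_W R n -> (J \o J = - \1)%VF -> omega_W R n (J u) (J v) = omega_W R n u v.
  move=> /Q_WP[q q0 EJ] JJ.
  have sk a b : omega_W R n (Jq q a) b = - omega_W R n a (Jq q b).
    have [x [z ->]] := tvecP a; have [x' [z' ->]] := tvecP b.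
    rewrite !JqE !omegaE !qmulNr !retrN [retr (qmul z' (qmul x q))]retr_mulC.
    rewrite -[qmul (qmul x q) z']qmulA -[qmul (qmul q z) x']qmulA.
    by rewrite [retr (qmul x _)]retr_mulC [retr (qmul q (qmul z x'))]retr_mulC
      -[qmul (qmul z x') q]qmulA; ring.
  have JJv : Jq q (Jq q v) = - v.
    by have := congr1 (fun f : 'End(tangent) => f v) JJ; rewrite EJ comp_lfunE opp_lfunE id_lfunE.
  rewrite EJ sk JJv.
  have := @omega_linearl R n u (-1) v 0; rewrite addr0 scaleN1r => E.
  rewrite omega_anti opprK E.
  have z0 : omega_W R n 0 u = 0.
    by have := @omega_linearl R n u (-1) u u; rewrite scaleN1r addNr => ->;
      rewrite [_ *: _]mulN1r addNr.
  by rewrite z0 addr0 [_ *: _]mulN1r [in RHS]omega_anti.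
have m J : J \in [:: J1; J2; J3] -> J \in Q_W R n by rewrite Q; exact: memv_span.
by split; apply: S; rewrite // m // !inE eqxx ?orbT.
Qed.

End QuaternionicStructure.

(** * The canonical connection *)

Section Functionals.
Context {R : realType}.

Definition coordH (W : vectType R) k : 'Hom(W, R^o) :=
  linfun (coord (vbasis {: W}) k : W -> R^o).

Lemma coordHE (W : vectType R) k (w : W) : coordH k w = coord (vbasis {: W}) k w.
Proof. by rewrite /coordH lfunE. Qed.

Lemma coordH_sum (W : vectType R) (w : W) :
  w = \sum_k (coordH k w : R) *: (vbasis {: W})`_k.
Proof. by rewrite {1}(coord_vbasis (memvf w)); apply: eq_bigr => k _; rewrite coordHE. Qed.

Lemma functionals_inj (W : vectType R) (u v : W) :
  (forall phi : 'Hom(W, R^o), phi u = phi v) -> u = v.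
Proof. by move=> uv; rewrite (coordH_sum u) (coordH_sum v); under eq_bigr do rewrite uv. Qed.

Lemma lin_expand (W : vectType R) (f : W -> R) (w : W) :
  (forall a u v, f (a *: u + v) = a * f u + f v) ->
  f w = \sum_k (coordH k w : R) * f (vbasis {: W})`_k.
Proof.
move=> lf.
have f0 : f 0 = 0 by have := lf (-1) 0 0; rewrite scaler0 addr0 mulN1r addNr.
have fD u v : f (u + v) = f u + f v by have := lf 1 u v; rewrite scale1r mul1r.
have fZ a u : f (a *: u) = a * f u by have := lf a u 0; rewrite !addr0 f0 addr0.
by rewrite {1}(coordH_sum w) (big_morph f fD f0); apply: eq_bigr => k _; rewrite fZ.
Qed.

Lemma bilin_expand (W1 W2 : vectType R) (f : W1 -> W2 -> R) (u : W1) (v : W2) :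
  (forall v a u u', f (a *: u + u') v = a * f u v + f u' v) ->
  (forall u a v v', f u (a *: v + v') = a * f u v + f u v') ->
  f u v = \sum_k \sum_l (coordH k u : R) * (coordH l v : R) *
     f (vbasis {: W1})`_k (vbasis {: W2})`_l.
Proof.
move=> l1 l2; rewrite (lin_expand u (l1 v)); apply: eq_bigr => k _.
by rewrite (lin_expand v (l2 _)) mulr_sumr; apply: eq_bigr => l _; rewrite mulrA.
Qed.

End Functionals.

Section VectorValued.
Context {R : realType} {V : normedModType R}.

Definition vec_pd (W : vectType R) (A v : V) (S : V -> W) (S' : W) : Prop :=
  forall phi : 'Hom(W, R^o), is_pd A v (fun B => phi (S B) : R) (phi S').

Lemma bilinear_pd (W1 W2 : vectType R) (f : W1 -> W2 -> R) A v S S' T T' :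
  (forall v a u u', f (a *: u + u') v = a * f u v + f u' v) ->
  (forall u a v v', f u (a *: v + v') = a * f u v + f u v') ->
  vec_pd A v S S' -> vec_pd A v T T' ->
  is_pd A v (fun B => f (S B) (T B)) (f S' (T A) + f (S A) T').
Proof.
move=> l1 l2 dS dT.
have -> : (fun B => f (S B) (T B)) = fun B =>
  \sum_k \sum_l (coordH k (S B) : R) * (coordH l (T B) : R) *
    f (vbasis {: W1})`_k (vbasis {: W2})`_l.
  by apply/funext => B; rewrite (bilin_expand _ _ l1 l2).
(* The terms with factor 0 are the derivatives of the constant coefficients; they give the sum the
   shape produced by [is_pdM]. *)
have -> : f S' (T A) + f (S A) T' = \sum_k \sum_l
   (((coordH k S' : R) * (coordH l (T A) : R)
      + (coordH k (S A) : R) * (coordH l T' : R)) * f (vbasis {: W1})`_k (vbasis {: W2})`_l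
    + (coordH k (S A) : R) * (coordH l (T A) : R) * 0).
  rewrite (bilin_expand S' (T A) l1 l2) (bilin_expand (S A) T' l1 l2) -big_split.
  apply: eq_bigr => k _; rewrite -big_split; apply: eq_bigr => l _ /=.
  by rewrite mulr0 addr0 mulrDl.
apply: is_pd_sum => k; apply: is_pd_sum => l.
exact (is_pdM (is_pdM (dS _) (dT _)) (is_pd_cst _ A v)).
Qed.

Lemma bilinear_smooth (U : set V) (W1 W2 : vectType R) (f : W1 -> W2 -> R) S T :
  open U ->
  (forall v a u u', f (a *: u + u') v = a * f u v + f u' v) ->
  (forall u a v v', f u (a *: v + v') = a * f u v + f u v') ->
  (forall phi : 'Hom(W1, R^o), smooth_on U (fun B => phi (S B))) ->
  (forall phi : 'Hom(W2, R^o), smooth_on U (fun B => phi (T B))) ->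
  smooth_on U (fun B => f (S B) (T B) : R^o).
Proof.
move=> oU l1 l2 sS sT.
have -> : (fun B => f (S B) (T B) : R^o) = fun B =>
  \sum_k \sum_l (coordH k (S B) : R) * (coordH l (T B) : R) *
    f (vbasis {: W1})`_k (vbasis {: W2})`_l.
  by apply/funext => B; rewrite (bilin_expand _ _ l1 l2).
apply: (smooth_sum oU) => k; apply: (smooth_sum oU) => l.
exact (smoothM oU (smoothM oU (sS _) (sT _)) (smooth_cst _)).
Qed.

End VectorValued.

Section CanonicalConnection.
Context {R : realType} {n : nat}.
Local Notation gl := (qmx R (1 + n) (1 + n)).
Local Notation PGL := (PGL R n).
Local Notation tangent := (tangent R n).
Local Notation G := (@GLH R (1 + n)).
Implicit Types (A B : gl) (g h : PGL) (X Y Z : PGL -> tangent).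

Let oG : open G := @open_GLH R n.

Lemma smooth_sectionE (W : vectType R) (s : PGL -> W) : smooth_section setT s <->
  forall phi : 'Hom(W, R^o), smooth_on G (fun A => phi (s (pclass A))).
Proof.
rewrite /smooth_section (_ : [set A : gl | GLH A /\ setT (Mproj (pclass A))] = G) //.
by apply/seteqP; split=> A /=; [case | split].
Qed.

Fact nab_key : unit. Proof. exact: tt. Qed.
(** The values lie in an arbitrary W: the tangent representation gives the connection,
    ['End(tangent)] its extension to endomorphisms, and [R^o] the derivative of lifted functions. *)
Definition nab : forall W : vectType R, (PGL -> tangent) -> (PGL -> W) -> PGL -> W :=
  locked_with nab_key (fun W X s g =>
   \sum_k pd (qmul (prep g) (vsval (X g))) (fun A => coordH k (s (pclass A)) : R) (prep g)
    *: (vbasis {: W})`_k).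
Arguments nab {W}.

Lemma nabE (W : vectType R) X (s : PGL -> W) g : nab X s g =
  \sum_k pd (qmul (prep g) (vsval (X g))) (fun A => coordH k (s (pclass A)) : R) (prep g)
    *: (vbasis {: W})`_k.
Proof. by rewrite /nab unlock. Qed.

Lemma pclass_notG A : ~ G A -> pclass A = pone R n.
Proof. by rewrite /pclass; case: pselect. Qed.

(** Also true off the group, where both sides take the default value. Thus functions of [pclass] are
    scale invariant on all of gl and [pd_comp_linear] applies to them. *)
Lemma pclass_scale r A : r != 0 -> pclass (r *: A) = pclass A.
Proof.
move=> r0; have [GA|nGA] := pselect (G A); first exact: pclassZ.
rewrite !pclass_notG // => GrA; apply: nGA.
by rewrite -[A](scalerK r0); apply: GLHZ; rewrite ?invr_eq0.
Qed.

(** Scaling by r carries the point A and the direction A u to r A and r A u, and fixes the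
    function. *)
Lemma pd_prep (f : PGL -> R) A u : G A ->
  pd (qmul (prep (pclass A)) u) (fun B => f (pclass B)) (prep (pclass A)) =
  pd (qmul A u) (fun B => f (pclass B)) A.
Proof.
move=> GA; have [r r0 ->] := prep_pclass GA.
have E : (fun B => f (pclass B)) \o (fun B => r *: B) = fun B => f (pclass B).
  by apply/funext => B /=; rewrite pclass_scale.
have L (a : R) (v w : gl) : r *: (a *: v + w) = a *: (r *: v) + r *: w.
  by rewrite scalerDr !scalerA mulrC.
have P := @pd_comp_linear R gl gl (fun B => r *: B) (fun B => f (pclass B)) A (qmul A u) L.
have Q := congr1 (fun F => pd (qmul A u) F A) E.
rewrite qmulZl; exact (etrans (esym P) Q).
Qed.

Lemma nab_vec_pd (W : vectType R) X (s : PGL -> W) A : smooth_section setT s -> G A ->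
  vec_pd A (qmul A (vsval (X (pclass A)))) (fun B => s (pclass B)) (nab X s (pclass A)).
Proof.
move=> /smooth_sectionE ss GA phi.
have -> : (fun B => phi (s (pclass B)) : R) = fun B =>
  \sum_k (coordH k (s (pclass B)) : R) * phi (vbasis {: W})`_k.
  apply/funext => B; rewrite {1}(coordH_sum (s (pclass B))) linear_sum.
  by apply: eq_bigr => k _; rewrite linearZ.
have -> : phi (nab X s (pclass A)) = \sum_k
   (pd (qmul A (vsval (X (pclass A)))) (fun A => coordH k (s (pclass A)) : R) A
      * phi (vbasis {: W})`_k
    + (coordH k (s (pclass A)) : R) * 0).
  rewrite nabE linear_sum; apply: eq_bigr => k _; rewrite linearZ mulr0 addr0.
  by rewrite (pd_prep (fun g => coordH k (s g) : R)).
apply: is_pd_sum => k; apply: is_pdM; last exact: is_pd_cst.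
exact: smooth_is_pd (ss (coordH k)) GA.
Qed.

Lemma nabP (W : vectType R) X (s : PGL -> W) A (phi : 'Hom(W, R^o)) :
  smooth_section setT s -> G A ->
  phi (nab X s (pclass A)) =
  pd (qmul A (vsval (X (pclass A)))) (fun B => phi (s (pclass B)) : R) A.
Proof. by move=> ss GA; rewrite (is_pd_pd (nab_vec_pd X ss GA phi)). Qed.

Lemma nab_smooth (W : vectType R) X (s : PGL -> W) :
  smooth_section setT X -> smooth_section setT s -> smooth_section setT (nab X s).
Proof.
move=> sX ss; apply/smooth_sectionE => phi.
have sF : smooth_on G (fun B => phi (s (pclass B))) by move: ss => /smooth_sectionE; apply.
apply: (@eq_smooth _ _ _ oG (fun A => \sum_k (coordH k (X (pclass A)) : R) *
   pd (qmul A (vsval (vbasis {: tangent})`_k)) (fun B => phi (s (pclass B)) : R) A)).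
  move=> A GA; rewrite (nabP _ _ ss GA).
  rewrite (@lin_expand _ _ (fun u : tangent =>
    pd (qmul A (vsval u)) (fun B => phi (s (pclass B)) : R) A)) //.
  move=> a u v; rewrite linearP qmulDr qmulZr.
  exact: (smooth_pd_linear oG sF GA).
apply: (smooth_sum oG) => k; apply: (smoothM oG).
  by move: sX => /smooth_sectionE; apply.
exact (smooth_pd_qmul oG _ sF).
Qed.

(** Right multiplication by h carries the direction of X at g to that at g h, so a linear relation
    between s at g h and s at g can be differentiated. The maps L1 and L2 cover the transformation
    rules of functions, vector fields and endomorphism fields at once. *)
Lemma nab_equivariant (W W' : vectType R) X (s : PGL -> W) h (L1 L2 : W -> W') :
  smooth_section setT s -> vector_field X -> G0 h -> linear L1 -> linear L2 ->
  (forall g, L1 (s (pmul g h)) = L2 (s g)) ->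
  forall g, L1 (nab X s (pmul g h)) = L2 (nab X s g).
Proof.
move=> ss vX Gh l1 l2 E g; apply: functionals_inj => psi.
rewrite -[L1 _](linfunE l1) -[L2 _](linfunE l2).
rewrite -[psi (linfun L1 _)]comp_lfunE -[psi (linfun L2 _)]comp_lfunE.
have GA := GLH_prep g; set A := prep g in GA.
have GH := GLH_prep h; set H := prep h in GH.
have GAH := GLHM GA GH.
rewrite -(pclass_prep g) -/A -{1}(pclass_prep h) -/H (pmulE GA GH).
rewrite (nabP X (psi \o linfun L1)%VF ss GAH) (nabP X (psi \o linfun L2)%VF ss GA).
(* Equivariance of X with the inverse of H moved to the other side. *)
have XE : qmul H (vsval (X (pclass (qmul A H)))) = qmul (vsval (X (pclass A))) H.
  have := vf_equivariant vX (pclass A) Gh.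
  rewrite -{2}(pclass_prep h) -/H (pmulE GA GH) => <-.
  rewrite (vsval_isotropy _ Gh) -{1}(pclass_prep h).
  have HH := prep_invP h.
  by rewrite (AdE _ HH) -qmulA (proj2 HH) qmul1r.
rewrite -qmulA XE qmulA.
rewrite -(@pd_comp_linear R gl gl (fun B => qmul B H)); last first.
  by move=> a u w; rewrite qmulDl qmulZl.
have sF : smooth_on G (fun B => (psi \o linfun L2)%VF (s (pclass B))).
  by move: ss => /smooth_sectionE; apply.
apply/esym/(eq_pd oG GA); last exact (is_pd_pdable (smooth_is_pd _ sF GA)).
move=> B GB /=; rewrite -(pmulE GB GH) pclass_prep !comp_lfunE (linfunE l1) (linfunE l2).
by rewrite E.
Qed.

End CanonicalConnection.

(** * Connection axioms, torsion, and parallelism of omega and Q *)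

Section ConnectionProperties.
Context {R : realType} {n : nat}.
Local Notation gl := (qmx R (1 + n) (1 + n)).
Local Notation PGL := (PGL R n).
Local Notation tangent := (tangent R n).
Local Notation G := (@GLH R (1 + n)).
Implicit Types (A B : gl) (g h : PGL) (X Y Z : PGL -> tangent) (f : @M R n -> R).

Let oG : open G := @open_GLH R n.

Lemma vf_funct X (phi : 'Hom(tangent, R^o)) : vector_field X ->
  smooth_on G (fun A => phi (X (pclass A))).
Proof. by move=> vX; move: (vf_smooth vX) => /smooth_sectionE; apply. Qed.

Lemma smooth_fun_section f : smooth_fun f -> smooth_section setT (fun g : PGL => f (Mproj g) : R^o).
Proof.
move=> sf; apply/smooth_sectionE => phi.
rewrite (_ : (fun A => _) = fun A => (f (Mproj (pclass A)) : R) * phi 1 : R^o).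
  exact (smoothM oG sf (smooth_cst _)).
by apply/funext => A; rewrite -[X in phi X]mulr1 -[X in phi X]/((f _ : R) *: (1 : R^o)) linearZ.
Qed.

(** [lie_deriv] is computed at the chosen representative of the coset. Equivariance of [nab] with
    trivial action removes the element of G_0, and [pd_prep] removes the real factor. *)
Lemma lie_derivE X f A : vector_field X -> smooth_fun f -> G A ->
  lie_deriv X f (Mproj (pclass A)) =
  pd (qmul A (vsval (X (pclass A)))) (fun B => f (Mproj (pclass B))) A.
Proof.
move=> vX sf GA.
have ss := smooth_fun_section sf.
have nE g : nab X (fun g : PGL => f (Mproj g) : R^o) g =
    pd (qmul (prep g) (vsval (X g))) (fun B => f (Mproj (pclass B))) (prep g).
  rewrite -{1}(pclass_prep g) -[LHS]id_lfunE (nabP X _ ss (GLH_prep g)) pclass_prep.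
  by congr (pd _ _ _); apply/funext => B; rewrite id_lfunE.
have [h Gh E] := Mrep_proj (pclass A).
rewrite /lie_deriv E -pdE -nE.
have -> : nab X (fun g : PGL => f (Mproj g) : R^o) (pmul (pclass A) h) =
          nab X (fun g : PGL => f (Mproj g) : R^o) (pclass A).
  apply: (@nab_equivariant _ _ _ _ _ _ _ id id ss vX Gh) => //.
  by move=> g; rewrite Mproj_mul.
rewrite nE; exact: (pd_prep (fun g => f (Mproj g)) _ GA).
Qed.

Lemma nab_vf X Y : vector_field X -> vector_field Y -> vector_field (nab X Y).
Proof.
move=> vX vY; split; first exact: (nab_smooth (vf_smooth vX) (vf_smooth vY)).
move=> g h Gh.
apply: (@nab_equivariant _ _ _ _ _ _ _ (isotropy h) id (vf_smooth vY) vX Gh) => //.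
  by move=> a u v; rewrite linearP.
by move=> g'; exact: (vf_equivariant vY).
Qed.

Lemma nab_addl X X' Y : vector_field Y -> nab (add_vf X X') Y = add_vf (nab X Y) (nab X' Y).
Proof.
move=> vY; apply/funext => g; apply: functionals_inj => phi.
rewrite /add_vf linearD /= -(pclass_prep g).
have GA := GLH_prep g; set A := prep g in GA *.
have E Z := nabP Z phi (vf_smooth vY) GA.
rewrite (E X).
rewrite (E X').
rewrite E.
rewrite linearD /= qmulDr.
have := smooth_pd_linear oG (vf_funct phi vY) GA 1
  (qmul A (vsval (X (pclass A)))) (qmul A (vsval (X' (pclass A)))).
by rewrite scale1r mul1r.
Qed.

Lemma nab_scalel (c : PGL -> R) X Y : vector_field Y ->
  nab (fun g => c g *: X g) Y = (fun g => c g *: nab X Y g).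
Proof.
move=> vY; apply/funext => g; apply: functionals_inj => phi.
rewrite linearZ -(pclass_prep g) /=.
have GA := GLH_prep g; set A := prep g in GA *.
have E Z := nabP Z phi (vf_smooth vY) GA.
rewrite (E X).
rewrite E.
rewrite linearZ /= qmulZr.
have L := smooth_pd_linear oG (vf_funct phi vY) GA.
have L0 : pd 0 (fun B => phi (Y (pclass B)) : R) A = 0.
  by have := L (-1) 0 0; rewrite scaler0 addr0 mulN1r addNr.
by have := L (c (pclass A)) (qmul A (vsval (X (pclass A)))) 0; rewrite !addr0 L0 addr0.
Qed.

Lemma nab_addr X Y Y' : vector_field Y -> vector_field Y' ->
  nab X (add_vf Y Y') = add_vf (nab X Y) (nab X Y').
Proof.
move=> vY vY'.
have sY : smooth_section setT (add_vf Y Y').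
  apply/smooth_sectionE => phi.
  rewrite (_ : (fun A => _) = fun A => (phi (Y (pclass A)) : R) + (phi (Y' (pclass A)) : R) : R^o).
    exact (smoothD oG (vf_funct phi vY) (vf_funct phi vY')).
  by apply/funext => A; rewrite /add_vf linearD.
apply/funext => g; apply: functionals_inj => phi.
rewrite -(pclass_prep g); have GA := GLH_prep g; set A := prep g in GA *.
rewrite (nabP _ phi sY GA) /add_vf linearD /= !(nabP _ phi (vf_smooth _) GA) //.
rewrite (_ : (fun B => _) = fun A => (phi (Y (pclass A)) : R) + (phi (Y' (pclass A)) : R)).
  exact (is_pd_pd (is_pdD (smooth_is_pd _ (vf_funct phi vY) GA)
    (smooth_is_pd _ (vf_funct phi vY') GA))).
by apply/funext => B; rewrite linearD.
Qed.

Lemma nab_leibniz f X Y : smooth_fun f -> vector_field X -> vector_field Y ->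
  nab X (scale_vf f Y) = add_vf (scale_vf (lie_deriv X f) Y) (scale_vf f (nab X Y)).
Proof.
move=> sf vX vY.
have FE (phi : 'Hom(tangent, R^o)) : (fun A => phi (scale_vf f Y (pclass A)) : R) =
    fun A => f (Mproj (pclass A)) * (phi (Y (pclass A)) : R).
  by apply/funext => A; rewrite /scale_vf linearZ.
have sY : smooth_section setT (scale_vf f Y).
  by apply/smooth_sectionE => phi; rewrite FE; exact (smoothM oG sf (vf_funct phi vY)).
apply/funext => g; apply: functionals_inj => phi.
rewrite -(pclass_prep g); have GA := GLH_prep g; set A := prep g in GA *.
rewrite (nabP _ phi sY GA) FE /add_vf /scale_vf linearD !linearZ /=.
rewrite (lie_derivE vX sf GA) (nabP _ phi (vf_smooth vY) GA).
exact (is_pd_pd (is_pdM (smooth_is_pd _ sf GA) (smooth_is_pd _ (vf_funct phi vY) GA))).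
Qed.

Lemma nab_connection : connection (@nab R n tangent).
Proof.
split.
- exact: nab_vf.
- by move=> X X' Y _ _; exact: nab_addl.
- by move=> X Y Y' _; exact: nab_addr.
- by move=> f X Y _ _ vY; exact: (nab_scalel (fun g => f (Mproj g)) X vY).
- exact: nab_leibniz.
Qed.

(* [1 + t s] lies in G_0 up to a real factor for small t, so that the functions
   lifted from M are constant along it. *)
Lemma pd_g_zero f A (a : qmx R 1 1) (d : qmx R n n) : G A ->
  pd (qmul A (qblock a 0 0 d)) (fun B => f (Mproj (pclass B))) A = 0.
Proof.
move=> GA; apply: is_pd_pd; apply: is_pd_eps => e e0.
have near1 : \forall B \near (qone (1 + n) : gl), G B.
  exact (near_open oG (@GLH1 R (1 + n)) (fun B GB => GB)).
have := near_seg1 (qblock a 0 0 d) near1.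
apply: filterS => t tP {near1}.
have GB := tP t (lexx _).
have E : t *: qmul A (qblock a 0 0 d) + A = qmul A (t *: qblock a 0 0 d + qone (1 + n)).
  by rewrite qmulDr qmulZr qmul1r.
have : G0 (pclass (t *: qblock a 0 0 d + qone (1 + n) : gl)).
  move: GB; rewrite -qblock1 qblockZ qblockD !scaler0 !addr0 => -[C].
  (* The diagonal blocks of the inverse invert the diagonal blocks of the matrix, as [G0_block]
     requires. *)
  have [c11 [c12 [c21 [c22 ->]]]] := qblockP C.
  rewrite /qinverse !qmul_block -qblock1 !qmul0l !qmul0r !addr0 !add0r.
  move=> [/qblock_inj[E1 _ _ E2] /qblock_inj[E3 _ _ E4]].
  apply: G0_block; last by exists c22.
  by apply: (@qinverseP1 _ _ c11).
move=> GH; rewrite E -(pmulE GA GB) (Mproj_mul _ GH) subrr mulr0 subr0 normr0.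
by rewrite mulr_ge0 // ltW.
Qed.

Lemma lie_smooth X f : vector_field X -> smooth_fun f -> smooth_fun (lie_deriv X f).
Proof.
move=> vX sf.
have sn : smooth_section setT (nab X (fun g : PGL => f (Mproj g) : R^o)).
  exact: (nab_smooth (vf_smooth vX) (smooth_fun_section sf)).
move/smooth_sectionE: sn => /(_ \1%VF) sn.
apply: (eq_smooth oG) sn => A GA.
rewrite (lie_derivE vX sf GA) (nabP _ _ (smooth_fun_section sf) GA).
by congr (pd _ _ _); apply/funext => B; rewrite id_lfunE.
Qed.

(** The product rule splits the variation of Y from that of the derivative of f. In the last term Y
    is frozen at its value at A, so it is a left-invariant field to which [pd_bracket] applies. *)
Lemma lie_lie X Y f A : vector_field X -> vector_field Y -> smooth_fun f -> G A ->
  lie_deriv X (lie_deriv Y f) (Mproj (pclass A)) =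
  pd (qmul A (vsval (nab X Y (pclass A)))) (fun B => f (Mproj (pclass B))) A
  + pd (qmul A (vsval (X (pclass A))))
       (fun B => pd (qmul B (vsval (Y (pclass A)))) (fun B => f (Mproj (pclass B))) B) A.
Proof.
move=> vX vY sf GA; have slf := lie_smooth vY sf.
rewrite (lie_derivE vX slf GA).
set w := qmul A (vsval (X (pclass A))).
set F := fun B => f (Mproj (pclass B)).
have sF : smooth_on G (F : gl -> R^o) := sf.
have lD B : G B -> forall a (u v : tangent),
    pd (qmul B (vsval (a *: u + v))) F B =
    a * pd (qmul B (vsval u)) F B + pd (qmul B (vsval v)) F B.
  move=> GB a u v; rewrite linearP /= qmulDr qmulZr.
  exact: (smooth_pd_linear oG sF GB).
pose D (k : 'I_(\dim {: tangent})) B := pd (qmul B (vsval (vbasis {: tangent})`_k)) F B.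
have sD k : smooth_on G (D k : gl -> R^o) := smooth_pd_qmul oG _ sF.
have dY k : is_pd A w (fun B => coordH k (Y (pclass B)) : R) (coordH k (nab X Y (pclass A))).
  exact: (nab_vec_pd X (vf_smooth vY) GA).
have S1 : is_pd A w (fun B => \sum_k (coordH k (Y (pclass B)) : R) * D k B)
   (\sum_k ((coordH k (nab X Y (pclass A)) : R) * D k A
      + (coordH k (Y (pclass A)) : R) * pd w (D k) A)).
  by apply: is_pd_sum => k; apply: is_pdM (dY k) (smooth_is_pd _ (sD k) GA).
(* The same sum with frozen coefficients: it differs from [S1] precisely by the derivative of Y. *)
have S2 : is_pd A w (fun B => \sum_k (coordH k (Y (pclass A)) : R) * D k B)
   (\sum_k (0 * D k A + (coordH k (Y (pclass A)) : R) * pd w (D k) A)).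
  by apply: is_pd_sum => k; apply: is_pdM (is_pd_cst _ _ _) (smooth_is_pd _ (sD k) GA).
have E1 : pd w (fun B => lie_deriv Y f (Mproj (pclass B))) A =
    pd w (fun B => \sum_k (coordH k (Y (pclass B)) : R) * D k B) A.
  apply: (eq_pd oG GA); last exact (is_pd_pdable (smooth_is_pd _ slf GA)).
  move=> B GB; rewrite (lie_derivE vY sf GB) -/F.
  exact: (lin_expand (Y (pclass B)) (lD B GB)).
have E2 : pd w (fun B => pd (qmul B (vsval (Y (pclass A)))) F B) A =
    pd w (fun B => \sum_k (coordH k (Y (pclass A)) : R) * D k B) A.
  apply: (eq_pd oG GA); last exact (is_pd_pdable (smooth_is_pd _ (smooth_pd_qmul oG _ sF) GA)).
  by move=> B GB; exact: (lin_expand (Y (pclass A)) (lD B GB)).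
rewrite E1 E2 (is_pd_pd S1) (is_pd_pd S2).
rewrite (lin_expand (nab X Y (pclass A)) (lD A GA)) -big_split /=.
by apply: eq_bigr => k _; rewrite mul0r add0r.
Qed.

Lemma sub_vf_vf X Y : vector_field X -> vector_field Y -> vector_field (sub_vf X Y).
Proof.
move=> vX vY; split.
  apply/smooth_sectionE => phi.
  rewrite (_ : (fun A => _) = fun A => (phi (X (pclass A)) : R)
      + (-1) * (phi (Y (pclass A)) : R) : R^o).
    exact (smoothD oG (vf_funct phi vX) (smoothM oG (smooth_cst _) (vf_funct phi vY))).
  by apply/funext => A; rewrite /sub_vf linearB mulN1r.
by move=> g h Gh; rewrite /sub_vf linearB /= (vf_equivariant vX) // (vf_equivariant vY).
Qed.

Lemma qlie_tangent (u v : tangent) :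
  exists a d, qlie (vsval u) (vsval v) = qblock a 0 0 d :> gl.
Proof.
have [x [z ->]] := tvecP u; have [x' [z' ->]] := tvecP v.
rewrite !vsval_tvec /qlie !qmul_block qblockN qblockD.
by rewrite !(qmul0l, qmul0r, addr0, add0r, oppr0); do 2!eexists.
Qed.

(** The [nab] terms of the two instances of [lie_lie] make up the left side. The remainder is a
    commutator of left-invariant fields, hence a derivative along a bracket in g_0. *)
Lemma nab_no_torsion : no_torsion (@nab R n tangent).
Proof.
move=> X Y f vX vY sf x.
have sXY := sub_vf_vf (nab_vf vX vY) (nab_vf vY vX).
rewrite -(Mproj_surj x) -(pclass_prep (Mrep x)).
have GA := GLH_prep (Mrep x); set A := prep _ in GA *.
rewrite (lie_lie vX vY sf GA) (lie_lie vY vX sf GA) (lie_derivE sXY sf GA).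
set F := fun B => f (Mproj (pclass B)).
have sF : smooth_on G (F : gl -> R^o) := sf.
have E : pd (qmul A (vsval (sub_vf (nab X Y) (nab Y X) (pclass A)))) F A =
  pd (qmul A (vsval (nab X Y (pclass A)))) F A - pd (qmul A (vsval (nab Y X (pclass A)))) F A.
  have := smooth_pd_linear oG sF GA (-1)
    (qmul A (vsval (nab Y X (pclass A)))) (qmul A (vsval (nab X Y (pclass A)))).
  by rewrite /sub_vf linearB /= qmulDr qmulNr scaleN1r mulN1r addrC => ->; rewrite addrC.
have [a [d ad]] := qlie_tangent (X (pclass A)) (Y (pclass A)).
have Z : pd (qmul A (qblock a 0 0 d)) F A = 0 := pd_g_zero f a d GA.
have BR := pd_bracket oG (vsval (X (pclass A))) (vsval (Y (pclass A))) sF GA.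
rewrite ad Z in BR; rewrite E opprD addrACA BR addr0.
by [].
Qed.

Lemma vf_G0 X g h : vector_field X -> G0 h -> isotropy h (X (pmul g h)) = X g.
Proof. by move=> vX; exact: (vf_equivariant vX). Qed.

Lemma omega_bilinear : (forall v a (u u' : tangent), omega_W R n (a *: u + u') v =
    a * omega_W R n u v + omega_W R n u' v) /\
  (forall u a (v v' : tangent), omega_W R n u (a *: v + v') =
    a * omega_W R n u v + omega_W R n u v').
Proof.
have L v a (u u' : tangent) : omega_W R n (a *: u + u') v =
    a * omega_W R n u v + omega_W R n u' v by exact: (omega_linearl v a u u').
split=> // u a v v'.
by rewrite (omega_anti u) L opprD -mulrN (omega_anti u v) (omega_anti u v').
Qed.

(** The representative chosen by [Mrep] differs from g by an element of G_0, which preserves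
    omega. *)
Lemma eval_omega Y Z g : vector_field Y -> vector_field Z ->
  eval_form (fun _ => omega_W R n) Y Z (Mproj g) = omega_W R n (Y g) (Z g).
Proof.
move=> vY vZ; rewrite /eval_form; have [h Gh ->] := Mrep_proj g.
by rewrite -(omega_isotropy _ _ Gh) !vf_G0.
Qed.

Lemma nab_preserves_form : preserves_form (@nab R n tangent) (fun _ => omega_W R n).
Proof.
move=> X Y Z vX vY vZ x; have [l1 l2] := omega_bilinear.
rewrite -(Mproj_surj x) -(pclass_prep (Mrep x)).
have GA := GLH_prep (Mrep x); set A := prep _ in GA *.
have FE : (fun B => eval_form (fun _ => omega_W R n) Y Z (Mproj (pclass B))) =
  fun B => omega_W R n (Y (pclass B)) (Z (pclass B)).
  by apply/funext => B; rewrite eval_omega.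
have sf : smooth_fun (eval_form (fun _ => omega_W R n) Y Z).
  rewrite /smooth_fun FE; apply: (bilinear_smooth oG l1 l2) => phi.
    exact: (vf_funct phi vY).
  exact: (vf_funct phi vZ).
rewrite (lie_derivE vX sf GA) FE (eval_omega _ (nab_vf vX vY) vZ) (eval_omega _ vY (nab_vf vX vZ)).
exact (is_pd_pd (bilinear_pd l1 l2 (nab_vec_pd X (vf_smooth vY) GA)
  (nab_vec_pd X (vf_smooth vZ) GA))).
Qed.

Lemma nab_preserves_Q (Q : {vspace 'End(tangent)}) :
  preserves_Q (@nab R n tangent) (fun _ => Q).
Proof.
move=> X J vX [[sJ eJ] QJ].
have ss (phi : 'Hom('End(tangent), R^o)) : smooth_on G (fun A => phi (J (pclass A))).
  by move: sJ => /smooth_sectionE; apply.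
exists (nab X J).
  split.
    split; first exact: (nab_smooth (vf_smooth vX) sJ).
    move=> g h _ Gh.
    (* The two sides of the equivariance of an endomorphism field, as linear maps of the
       endomorphism. *)
    pose L1 (f : 'End(tangent)) : 'End(tangent) := (isotropy h \o f)%VF.
    pose L2 (f : 'End(tangent)) : 'End(tangent) := (f \o isotropy h)%VF.
    have l1 : linear L1.
      by move=> a u v; apply/lfunP => w; rewrite !(comp_lfunE, add_lfunE, scale_lfunE) linearP.
    have l2 : linear L2.
      by move=> a u v; apply/lfunP => w; rewrite !(comp_lfunE, add_lfunE, scale_lfunE).
    exact: (nab_equivariant sJ vX Gh l1 l2 (fun g' => eJ g' h I Gh) g).
  (* J is fixed by the projection onto the constant space Q, and differentiation commutes with this
     linear map. *)
  move=> g; suff -> : nab X J g = projv Q (nab X J g) by exact: memv_proj.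
  apply: functionals_inj => phi; rewrite -(pclass_prep g) -[RHS]comp_lfunE.
  have GA := GLH_prep g.
  rewrite (nabP X phi sJ GA) (nabP X (phi \o projv Q)%VF sJ GA).
  by congr (pd _ _ _); apply/funext => B; rewrite comp_lfunE projv_id.
move=> Y vY.
have l1 (phi : 'Hom(tangent, R^o)) (v : tangent) a (u u' : 'End(tangent)) :
    phi ((a *: u + u') v) = (a : R) * (phi (u v) : R) + (phi (u' v) : R) :> R.
  by rewrite add_lfunE scale_lfunE linearP.
have l2 (phi : 'Hom(tangent, R^o)) (u : 'End(tangent)) a (v v' : tangent) :
    phi (u (a *: v + v')) = (a : R) * (phi (u v) : R) + (phi (u v') : R) :> R.
  by rewrite !linearP.
have sJY : smooth_section setT (fun g => J g (Y g)).
  apply/smooth_sectionE => phi.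
  have H := @bilinear_smooth R gl G 'End(tangent) tangent (fun u v => phi (u v) : R)
    (fun B => J (pclass B)) (fun B => Y (pclass B)) oG (l1 phi) (l2 phi) ss
    (fun psi => vf_funct psi vY).
  exact H.
apply/funext => g; apply: functionals_inj => phi.
rewrite -(pclass_prep g) (nabP X phi sJY (GLH_prep g)) /add_vf linearD.
exact (is_pd_pd (@bilinear_pd _ _ 'End(tangent) tangent (fun u v => phi (u v) : R)
  _ _ _ _ _ _ (l1 phi) (l2 phi) (nab_vec_pd X sJ (GLH_prep g))
  (nab_vec_pd X (vf_smooth vY) (GLH_prep g)))).
Qed.

End ConnectionProperties.

(** * Local frames of Q *)

Section AlmostQuaternionic.
Context {R : realType} {n : nat}.
Local Notation gl := (qmx R (1 + n) (1 + n)).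
Local Notation PGL := (PGL R n).
Local Notation tangent := (tangent R n).
Local Notation G := (@GLH R (1 + n)).
Implicit Types (A B : gl) (g h : PGL) (p q : qmx R 1 1) (i : 'I_(1 + n)).
Context (n_gt0 : (0 < n)%N).

Let oG : open G := @open_GLH R n.

Definition col0 : qmx R (1 + n) 1 := (col_mx 1%:M 0, 0, 0, 0).
Definition first_col A : qmx R (1 + n) 1 := qmul A col0.
(** Written as a product with a unit row, so that associativity yields its behaviour under right
    multiplication. *)
Definition entry i A : qmx R 1 1 := qmul (qiota (inord 0) (delta_mx 0 i)) (first_col A).

Lemma first_col_block A (a : qmx R 1 1) (D : qmx R n n) :
  first_col (qmul A (qblock a 0 0 D)) = qmul (first_col A) a.
Proof.
rewrite /first_col -!qmulA; congr qmul.
move: a D => [[[a0 a1] a2] a3] [[[d0 d1] d2] d3].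
rewrite /qblock /qmul /col0 /qre /qimi /qimj /qimk /=.
rewrite !mulmx0 !mul0mx !(subr0, addr0, add0r) !mul_block_col !mul_col_mx.
by rewrite !mulmx0 !mulmx1 !mul1mx !mul0mx !addr0.
Qed.

Lemma entry_block i A (a : qmx R 1 1) (D : qmx R n n) :
  entry i (qmul A (qblock a 0 0 D)) = qmul (entry i A) a.
Proof. by rewrite /entry first_col_block qmulA. Qed.

Lemma entry_linear i : linear (entry i).
Proof. by move=> a A B; rewrite /entry /first_col qmulDl qmulDr qmulZl qmulZr. Qed.

Lemma entryZ i r A : entry i (r *: A) = r *: entry i A.
Proof. by rewrite /entry /first_col qmulZl qmulZr. Qed.

(** If the first column A e vanished, then e = A^-1 A e would vanish. *)
Lemma entry_exists A : G A -> exists i, entry i A != 0.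
Proof.
move=> [B [AB BA]]; apply: contrapT => nex.
have e0 i : entry i A = 0 by apply/eqP/negPn/negP => ei; apply: nex; exists i.
have c0 : first_col A = 0.
  apply: qmx_eq0 => t i j; rewrite ord1.
  have := congr1 (fun v : qmx R 1 1 => qcomp t v 0 0) (e0 i).
  rewrite /entry; move: (first_col A) => [[[v0 v1] v2] v3].
  rewrite /qiota inordK //= /qmul /qcomp /qre /qimi /qimj /qimk /=.
  case: t => -[|[|[|k]]] Ht /=; rewrite !mul0mx !(subr0, addr0, add0r) -rowE !mxE;
  by move=> ->; rewrite ?mxE.
have : qmul B (first_col A) = col0 by rewrite /first_col qmulA BA qmul1l.
rewrite c0 qmul0r => /(congr1 (fun v : qmx R (1 + n) 1 => qre v (lshift n 0) 0)).
rewrite /col0 /qre /= col_mxEu !mxE eqxx => /eqP.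
by rewrite eq_sym oner_eq0.
Qed.

(* [q^-1 p q], for [q] nonzero *)
Definition qconjug p q := (qnorm2 q)^-1 *: qmul (qmul (qconj q) p) q.

Lemma qconjugE p q q' : qinverse q q' -> qconjug p q = qmul (qmul q' p) q.
Proof.
move=> qq'; have q0 := qinverseP1 qq'.
by rewrite (qinverse_uniq qq' (qinverse1 q0)) /qconjug !qmulZl.
Qed.

Lemma qconjugZ p q (r : R) : r != 0 -> q != 0 -> qconjug p (r *: q) = qconjug p q.
Proof.
move=> r0 /qinverse1; move: (_ *: qconj q) => q' qq'.
rewrite (qconjugE _ qq') (qconjugE _ (qinverseZ r0 qq')).
rewrite !(qmulZl, qmulZr) scalerA.
by rewrite divff ?scale1r.
Qed.

Lemma qmul_neq0 p q : p != 0 -> q != 0 -> qmul p q != 0.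
Proof. by rewrite -!qnorm2_eq0 qnorm2M => p0 q0; rewrite mulf_neq0. Qed.

Definition Jfield i p g : 'End(tangent) := Jq (qconjug p (entry i (prep g))).

Definition chart i : set (@M R n) := [set y | entry i (prep (Mrep y)) != 0].

Lemma entry_prep i A : G A -> exists2 r, r != 0 & entry i (prep (pclass A)) = r *: entry i A.
Proof. by move=> GA; have [r r0 ->] := prep_pclass GA; exists r; rewrite ?entryZ. Qed.

Lemma entry_pmul i g h : G0 h -> exists r a b D E,
  [/\ r != 0, qinverse a b, qinverse D E, h = pclass (qblock a 0 0 D) &
   entry i (prep (pmul g h)) = r *: qmul (entry i (prep g)) a].
Proof.
move=> /G0P[a [b [D [E [a1 ab DE hE]]]]].
have GH : GLH (qblock a 0 0 D) by apply: GLH_block; [exact: Sp1_neq0 | exists E].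
have GA := GLH_prep g.
have [r r0 rE] := entry_prep i (GLHM GA GH).
exists r, a, b, D, E; split => //.
by rewrite hE -{1}(pclass_prep g) (pmulE GA GH) rE entry_block.
Qed.

Lemma scale_neq0 (r : R) q : r != 0 -> (r *: q != 0) = (q != 0).
Proof. by move=> r0; rewrite scaler_eq0 negb_or r0. Qed.

Lemma chartE i g : chart i (Mproj g) <-> entry i (prep g) != 0.
Proof.
rewrite /chart /=; have [h Gh ->] := Mrep_proj g.
have [r [a [b [D [E [r0 ab _ _ ->]]]]]] := entry_pmul i g Gh.
rewrite (scale_neq0 _ r0); split => [|q0]; last by apply: qmul_neq0 q0 (qinverseP1 ab).
by apply: contra => /eqP ->; rewrite qmul0l.
Qed.

Lemma chart_pclass i A : G A -> chart i (Mproj (pclass A)) <-> entry i A != 0.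
Proof.
by move=> GA; rewrite chartE; have [r r0 ->] := entry_prep i GA; rewrite scale_neq0.
Qed.

Definition cdom i : set gl := [set A | GLH A /\ chart i (Mproj (pclass A))].

Lemma bilinear_entry_smooth (U : set gl) i (f : qmx R 1 1 -> qmx R 1 1 -> R) : open U ->
  (forall v a u u', f (a *: u + u') v = a * f u v + f u' v) ->
  (forall u a v v', f u (a *: v + v') = a * f u v + f u v') ->
  smooth_on U (fun A => f (entry i A) (entry i A) : R^o).
Proof.
move=> oU l1 l2; apply: (bilinear_smooth oU l1 l2) => phi;
  by apply: smooth_linear => a A B; rewrite entry_linear linearP.
Qed.

Lemma qconj_linear : linear (@qconj R 1 1).
Proof.
move=> a [[[a0 a1] a2] a3] [[[b0 b1] b2] b3].
by rewrite /qconj /qre /qimi /qimj /qimk /=; congr (_, _, _, _);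
  rewrite /= ?opprD ?scalerN.
Qed.

Lemma smooth_qnorm2_entry (U : set gl) i : open U ->
  smooth_on U (fun A => qnorm2 (entry i A) : R^o).
Proof.
move=> oU; apply: (eq_smooth oU)
  (_ : smooth_on U (fun A => retr (qmul (qconj (entry i A)) (entry i A)) : R^o)).
  by move=> A _; rewrite (proj2 (qconjP _)) retrZ retr1 mulr1.
apply: (bilinear_entry_smooth (f := fun u v => retr (qmul (qconj u) v)) i oU)
    => [v a u u'|u a v v'].
  by rewrite qconj_linear qmulDl qmulZl retrD retrZ.
by rewrite qmulDr qmulZr retrD retrZ.
Qed.

Lemma open_cdom i : open (cdom i).
Proof.
have -> : cdom i = G `&` [set A | qnorm2 (entry i A) != 0].
  apply/seteqP; split=> A /= [GA]; rewrite qnorm2_eq0.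
    by move/chart_pclass => /(_ GA).
  by move=> eA; exact: (conj GA (proj2 (chart_pclass i GA) eA)).
apply: openI; first exact: oG.
apply: (@open_comp _ _ (fun A => qnorm2 (entry i A)) [set x : R | x != 0]); last exact: open_neq.
by move=> A _; apply: (smooth_cvg (smooth_qnorm2_entry i openT)).
Qed.

(** Smoothness: q^-1 p q is quadratic in the entry q, divided by its squared norm. Equivariance:
    replacing q by q a conjugates q^-1 p q by a, which is how G_0 acts on [Jq]. *)
Lemma Jfield_end i p : end_field (chart i) (Jfield i p).
Proof.
split=> [phi|g h gU Gh].
  rewrite -/(cdom i).
  (* The quadratic numerator, polarised to a bilinear form. *)
  pose f u v : R := phi (Jq (qmul (qmul (qconj u) p) v)).
  have JlinR a u v : phi (Jq (a *: u + v)) = (a : R) * (phi (Jq u) : R) + (phi (Jq v) : R) :> R.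
    by rewrite Jq_linear linearP.
  have oU := @open_cdom i.
  have s1 : smooth_on (cdom i) (fun A => f (entry i A) (entry i A) : R^o).
    apply: (bilinear_entry_smooth i oU) => [v a u u'|u a v v']; rewrite /f.
      by rewrite qconj_linear !qmulDl !qmulZl JlinR.
    by rewrite qmulDr qmulZr JlinR.
  have s2 : smooth_on (cdom i) (fun A => (qnorm2 (entry i A))^-1 : R^o).
    apply: (smoothV oU) (smooth_qnorm2_entry i oU) => A [GA].
    by rewrite qnorm2_eq0 => /chart_pclass; apply.
  apply: (eq_smooth oU) (smoothM oU s2 s1) => A [GA /(chart_pclass i GA) eA].
  rewrite /Jfield; have [r r0 ->] := entry_prep i GA.
  rewrite (qconjugZ _ r0 eA) /qconjug /f.
  by have := JlinR (qnorm2 (entry i A))^-1 (qmul (qmul (qconj (entry i A)) p) (entry i A)) 0;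
    rewrite Jq0 linear0 !addr0.
move/chartE: gU => q0.
have [r [a [b [D [E [r0 ab DE -> rE]]]]]] := entry_pmul i g Gh.
set q := entry i (prep g) in q0 rE.
have qq' := qinverse1 q0; move: (_ *: qconj q) qq' => q' qq'.
apply: end_tvecP => x z; rewrite !comp_lfunE (isotropy_tvec _ _ ab DE) /Jfield rE -/q.
rewrite (qconjugZ _ r0) ?(qmul_neq0 q0) ?(qinverseP1 ab) //.
rewrite (qconjugE _ (qinverseM qq' ab)) (qconjugE _ qq').
apply: etrans (congr1 (isotropy _) (JqE _ x z)) _.
apply: etrans (isotropy_tvec _ _ ab DE) _; apply: etrans _ (esym (JqE _ _ _)).
rewrite (qmulNr D) (qmulNl _ b).
congr (tvec (- _) _); rewrite -!qmulA.
  by rewrite (proj1 ab) qmul1r.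
by rewrite [qmul a (qmul b _)]qmulA (proj1 ab) qmul1l.
Qed.

Lemma almost_quaternionic_Q_W : almost_quaternionic (fun _ : PGL => Q_W R n).
Proof.
split=> [g|x]; first by have [] := triple_spans n_gt0 (@qunit_triple R).
have [i ei] := entry_exists (GLH_prep (Mrep x)).
exists (chart i), (Jfield i (qunit 1)), (Jfield i (qunit 2)), (Jfield i (qunit 3)).
split; [exact: (@open_cdom i) | exact: ei | by split; exact: Jfield_end |].
move=> g /chartE q0; rewrite /Jfield !(qconjugE _ (qinverse1 q0)).
exact: (proj2 (triple_spans n_gt0 (conj_triple (qinverse1 q0) (@qunit_triple R)))).
Qed.

Lemma two_form_omega : two_form (fun _ : PGL => omega_W R n).
Proof.
split.
- by move=> _ v; exact: omega_linearl.
- by move=> _ u; exact: omega_alt.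
- by move=> u v phi; exact: smooth_cst.
- by move=> g h u v Gh; rewrite omega_isotropy.
Qed.

Lemma quaternionic_skew_Hermitian_W :
  quaternionic_skew_Hermitian (fun _ : PGL => Q_W R n) (fun _ => omega_W R n).
Proof.
split; first exact: almost_quaternionic_Q_W.
  split; first exact: two_form_omega.
    by move=> _ u; exact: omega_nondeg.
  by move=> _ J1 J2 J3; exact: omega_hermitian.
exists (@nab R n tangent); split.
- exact: nab_connection.
- exact: nab_no_torsion.
- exact: nab_preserves_Q.
- exact: nab_preserves_form.
Qed.

End AlmostQuaternionic.

Theorem proposition5p4 (R : realType) (n : nat) (n_gt1 : (1 < n)%N) :
  ((\dim (sl R n) = \dim (g_zero R n) + 8 * n)%N /\
   \dim {: tangent R n} = (8 * n)%N) /\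
  (exists (Q : PGL R n -> {vspace 'End(tangent R n)})
          (w : PGL R n -> tangent R n -> tangent R n -> R),
    [/\ quaternionic_skew_Hermitian Q w,
        G_invariant Q /\ G_invariant w,
        Q (pone R n) = Q_W R n
      & w (pone R n) = omega_W R n]) /\
  neg_is_EH R n /\ killing_duality R n.
Proof.
split; first by split; [exact: dim_sl_g_zero | exact: dim_tangent].
split; last by split; [exact: neg_is_EH_holds | exact: killing_duality_holds].
(* For constant functions on G, invariance and the values at the base point hold by computation. *)
exists (fun _ => Q_W R n), (fun _ => omega_W R n); split => //.
exact: (quaternionic_skew_Hermitian_W (ltnW n_gt1)).
Qed.
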